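(* For every integer $n\geq 2$ there exists a constant $C$, and for all $a,b\geq 0$ there exists $\mu(a,b)>0$, such that the following holds. Let $\mathbb{H}^n=\{(x_0,\bar x): x_0\in[0,\infty),\ \bar x\in\mathbb{R}^{n-1}\}$ with the Euclidean metric, let $y\in\mathbb{H}^n$, $r>0$, and $D_r(y):=B_r(y)\cap\mathbb{H}^n$, where $B_r(y)$ is the Euclidean open ball of radius $r$ centered at $y$. Suppose that $e\in C^2(D_r(y),[0,\infty))$ satisfies, for some constants $A_0,A_1,B_0,B_1\geq 0$, $$\Delta e \leq A_0 + A_1 e + a\, e^{\frac{n+2}{n}} \ \text{ on } D_r(y), \qquad \frac{\partial}{\partial\nu}\Big|_{\partial\mathbb{H}^n} e \leq B_0 + B_1 e + b\, e^{\frac{n+1}{n}} \ \text{ on } D_r(y)\cap\partial\mathbb{H}^n,$$ and $$\int_{D_r(y)} e \leq \mu(a,b).$$ Then $$e(y) \leq C A_0 r^2 + C B_0 r + C\bigl(A_1^{\frac n2} + B_1^n + r^{-n}\bigr)\int_{D_r(y)} e.$$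
   Context: $\Delta = -\sum_{k}\partial_{x_k}^2$ is the positive definite Euclidean Laplacian, and the outer normal derivative on $\partial\mathbb{H}^n=\{x_0=0\}$ is $\frac{\partial}{\partial\nu} = -\frac{\partial}{\partial x_0}\big|_{x_0=0}$. *)

(* Defs.v *)
From HB Require Import structures.
From mathcomp Require Import all_boot all_order all_algebra.
From mathcomp Require Import all_classical all_reals all_analysis.
Set Implicit Arguments. Unset Strict Implicit. Unset Printing Implicit Defensive.
Import Order.TTheory GRing.Theory Num.Theory.
Import numFieldNormedType.Exports.
Local Open Scope classical_set_scope.
Local Open Scope ring_scope.

(* Euclidean open ball B_r(y) (the library's ball on 'rV is the sup-norm ball). *)
Definition eball (R : realType) (n : nat) (y : 'rV[R]_n) (r : R) : set 'rV[R]_n :=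
  [set x | \sum_(k < n) (x 0 k - y 0 k) ^+ 2 < r ^+ 2].

Definition partial (R : realType) (n : nat) (k : 'I_n) (f : 'rV[R]_n -> R)
  (x : 'rV[R]_n) : R := 'D_(delta_mx 0 k) f x.

(* Positive definite Laplacian: Delta f = - sum_k d_k^2 f. *)
Definition laplacian (R : realType) (n : nat) (f : 'rV[R]_n -> R) (x : 'rV[R]_n) : R :=
  - \sum_(k < n) partial k (partial k f) x.

Definition C2_on (R : realType) (n : nat) (D : set 'rV[R]_n) (f : 'rV[R]_n -> R) : Prop :=
  exists U : set 'rV[R]_n, [/\ open U, D `<=` U,
    (forall x, U x -> differentiable f x),
    (forall k x, U x -> differentiable (partial k f) x) &
    (forall k l x, U x -> {for x, continuous (partial l (partial k f))})].

(* Lebesgue integral over R^n of a nonnegative function, computed as the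
   iterated one-dimensional Lebesgue integral (Tonelli). *)
Fixpoint iint (R : realType) (n : nat) : ('rV[R]_n -> \bar R) -> \bar R :=
  match n return ('rV[R]_n -> \bar R) -> \bar R with
  | 0 => fun f => f 0
  | m.+1 => fun f =>
      (\int[@lebesgue_measure R]_t iint (fun v : 'rV[R]_m => f (row_mx (t%:M) v)))%E
  end.

Definition int_over (R : realType) (n : nat) (D : set 'rV[R]_n) (f : 'rV[R]_n -> R) : \bar R :=
  iint (fun x => ((x \in D)%:R * f x)%:E).

(* Main.v *)
Require Import Defs.
From HB Require Import structures.
From mathcomp Require Import all_boot all_order all_algebra.
From mathcomp Require Import ring lra.
From mathcomp Require Import all_classical all_reals all_analysis measurable_realfun.
Set Implicit Arguments.
Unset Strict Implicit.
Unset Printing Implicit Defensive.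

Import Order.TTheory GRing.Theory Num.Theory.
Import numFieldNormedType.Exports.
Local Open Scope classical_set_scope.
Local Open Scope ring_scope.

(** Heinz' trick. On the sup-norm ball of radius [R0 = r / n] around [y],
    maximize [(R0 - |x - y|)^n e x]. Near a maximum point [x], the function [e] is at most
    [2^n e x], so the nonlinear right-hand sides become constants [A], [B], and the
    linear mean value inequality [e x <= K (A l^2 + B l + l^-n \int e)] applies at a
    scale [l] so small that, thanks to the smallness of [\int e], all nonlinear
    contributions are absorbed in the left-hand side.

    For the mean value inequality, [v = e + A/2 (z_1 - x_1)^2 + B (z_0 - a)] is
    subharmonic with nonnegative [x_0]-derivative on the boundary, and is tested
    against the sum of a radial kernel [g(|z - x|^2)] and its mirror image, where
    [g'(q) = - (q^2 + rho^4)^(-n/4) (1 - (q / l^2)^n)_+^2]. The Laplacian of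
    the kernel is a bounded part of size [l^-n] minus an approximate unit mass at [x].
    Integration by parts is carried out on Riemann sums, where it is a telescoping
    sum, so no Fubini theorem or differentiation under the integral is needed; the
    sums are compared with the iterated integral only at the end, which needs
    monotonicity but no measurability. *)


(** * Riemann sums over product grids *)

Definition gridbox {R : realType} {m} (N : nat) (al h : nat -> R) (z : 'rV[R]_m) : Prop :=
  forall k : 'I_m, al k <= z 0 k <= al k + N%:R * h k.

(** Left-endpoint sum with [N] cells per axis; it peels off the first coordinate exactly as [iint]
    does. Indexing [al] and [h] by [nat] turns the removal of that coordinate into a shift. *)
Fixpoint rsum {R : realType} {m} (N : nat) (al h : nat -> R) :
    ('rV[R]_m -> R) -> R :=
  match m return ('rV[R]_m -> R) -> R with
  | 0 => fun f => f 0
  | m'.+1 => fun f => \sum_(i < N) h 0%N *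
      @rsum R m' N (fun k => al k.+1) (fun k => h k.+1)
        (fun v : 'rV[R]_(m') => f (row_mx ((al 0%N + i%:R * h 0%N)%:M) v))
  end.

Section RiemannSum.
Context {R : realType}.
Implicit Types (m N : nat) (al h : nat -> R).

Lemma row_mx_cons0 m (t : R) (v : 'rV[R]_m) :
  row_mx (t%:M : 'M[R]_1) v 0 (ord0 : 'I_m.+1) = t.
Proof.
have -> : (ord0 : 'I_m.+1) = lshift m (ord0 : 'I_1) by apply/val_inj.
by rewrite row_mxEl mxE eqxx mulr1n.
Qed.

Lemma row_mx_consS m (t : R) (v : 'rV[R]_m) (k : 'I_m) :
  row_mx (t%:M : 'M[R]_1) v 0 (lift ord0 k : 'I_m.+1) = v 0 k.
Proof.
have -> : (lift ord0 k : 'I_m.+1) = rshift 1 k by apply/val_inj.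
by rewrite row_mxEr.
Qed.

Lemma forall_ordS m (P : 'I_m.+1 -> Prop) :
  P ord0 -> (forall k : 'I_m, P (lift ord0 k)) -> forall k, P k.
Proof. by move=> P0 PS k; case: (unliftP ord0 k) => [j|] ->. Qed.

Lemma add_delta_row0 m (a t : R) (v : 'rV[R]_m) :
  a *: delta_mx 0 (ord0 : 'I_m.+1) + row_mx (t%:M : 'M[R]_1) v =
  row_mx ((a + t)%:M : 'M[R]_1) v.
Proof.
apply/rowP; apply: forall_ordS => [|k]; rewrite 3!mxE.
  by rewrite !row_mx_cons0 !eqxx mulr1.
by rewrite !row_mx_consS eqxx /= mulr0 add0r.
Qed.

Lemma add_delta_rowS m (a t : R) (v : 'rV[R]_m) (k : 'I_m) :
  a *: delta_mx 0 (lift ord0 k : 'I_m.+1) + row_mx (t%:M : 'M[R]_1) v =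
  row_mx (t%:M : 'M[R]_1) (a *: delta_mx 0 k + v).
Proof.
apply/rowP; apply: forall_ordS => [|j]; rewrite 3!mxE.
  by rewrite !row_mx_cons0 eqxx /= mulr0 add0r.
by rewrite !row_mx_consS !mxE eqxx.
Qed.

Lemma gridbox_cons m N al h t (v : 'rV[R]_m) :
  gridbox (m := m.+1) N al h (row_mx (t%:M : 'M[R]_1) v) <->
  (al 0%N <= t <= al 0%N + N%:R * h 0%N) /\
  gridbox N (fun k => al k.+1) (fun k => h k.+1) v.
Proof.
split=> [b|[b0 b1]].
  split=> [|k]; first by have := b ord0; rewrite row_mx_cons0.
  by have := b (lift ord0 k); rewrite row_mx_consS.
by apply: forall_ordS => [|k]; rewrite ?row_mx_cons0 ?row_mx_consS//; exact: b1.
Qed.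

Lemma grid_node N (a b : R) (i : nat) : (i <= N)%N -> 0 <= b ->
  a <= a + i%:R * b <= a + N%:R * b.
Proof.
move=> iN b0; rewrite lerDl lerD2l mulr_ge0//= ler_wpM2r// ler_nat//.
Qed.

Lemma rsum_le m N al h (f g : 'rV[R]_m -> R) : (forall k, 0 <= h k) ->
  (forall z, gridbox N al h z -> f z <= g z) -> rsum N al h f <= rsum N al h g.
Proof.
elim: m al h f g => [|m IH] al h f g h0 fg /=.
  by apply: fg => -[].
apply: ler_sum => i _; apply: ler_wpM2l => //; apply: IH => // z bz.
by apply/fg/gridbox_cons; split => //; apply: grid_node => //; apply/ltnW.
Qed.

Lemma rsumD m N al h (f g : 'rV[R]_m -> R) :
  rsum N al h (fun z => f z + g z) = rsum N al h f + rsum N al h g.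
Proof.
elim: m al h f g => [|m IH] al h f g //=.
by rewrite -big_split; apply: eq_bigr => i _; rewrite IH mulrDr.
Qed.

Lemma rsumZ m N al h c (f : 'rV[R]_m -> R) :
  rsum N al h (fun z => c * f z) = c * rsum N al h f.
Proof.
elim: m al h f => [|m IH] al h f //=.
by rewrite mulr_sumr; apply: eq_bigr => i _; rewrite IH mulrCA.
Qed.

Lemma rsumB m N al h (f g : 'rV[R]_m -> R) :
  rsum N al h (fun z => f z - g z) = rsum N al h f - rsum N al h g.
Proof.
rewrite -[- rsum _ _ _ g]mulN1r -rsumZ -rsumD; congr rsum.
by apply/funext => z; rewrite mulN1r.
Qed.

(** Serves to evaluate the sums of constants and of the indicator of a cube. *)
Lemma rsum_prod m N al h (u : nat -> R -> R) :
  rsum N al h (fun z : 'rV[R]_m => \prod_(k < m) u k (z 0 k)) =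
  \prod_(k < m) \sum_(i < N) h k * u k (al k + i%:R * h k).
Proof.
elim: m al h u => [|m IH] al h u /=; first by rewrite !big_ord0.
rewrite big_ord_recl /= mulr_suml; apply: eq_bigr => i _.
rewrite -mulrA; congr (_ * _).
rewrite -(IH (fun k => al k.+1) (fun k => h k.+1) (fun k => u k.+1)) -rsumZ.
congr rsum; apply/funext => v; rewrite big_ord_recl row_mx_cons0; congr (_ * _).
by apply: eq_bigr => k _; rewrite row_mx_consS.
Qed.

Lemma rsum_cst m N al h c :
  rsum N al h (fun _ : 'rV[R]_m => c) = c * \prod_(k < m) (N%:R * h k).
Proof.
transitivity (rsum N al h (fun z : 'rV[R]_m =>
    c * \prod_(k < m) (fun (_ : nat) (_ : R) => 1) (k : nat) (z 0 k))).
  by congr rsum; apply/funext => z; rewrite big1 ?mulr1.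
rewrite rsumZ (rsum_prod m N al h (fun _ _ => 1)); congr (_ * _).
apply: eq_bigr => k _.
rewrite (eq_bigr (fun=> h k)); last by move=> i _; rewrite mulr1.
by rewrite sumr_const card_ord mulr_natl.
Qed.

Lemma rsum_ge0 m N al h (f : 'rV[R]_m -> R) : (forall k, 0 <= h k) ->
  (forall z, gridbox N al h z -> 0 <= f z) -> 0 <= rsum N al h f.
Proof.
move=> h0 f0; have -> : 0 = rsum N al h (fun _ : 'rV[R]_m => 0) by rewrite rsum_cst mul0r.
exact: rsum_le.
Qed.

(* Summation along the [k]-th axis telescopes, so only the two faces remain. *)
Lemma rsum_div m N al h (k : 'I_m) (F F' : 'rV[R]_m -> R) :
  (forall j, 0 <= h j) ->
  (forall z, gridbox N al h z -> h k + z 0 k <= al k + N%:R * h k ->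
     F (h k *: delta_mx 0 k + z) - F z <= h k * F' z) ->
  (forall z, gridbox N al h z -> z 0 k = al k + N%:R * h k -> 0 <= F z) ->
  (forall z, gridbox N al h z -> z 0 k = al k -> F z <= 0) ->
  0 <= rsum N al h F'.
Proof.
elim: m al h k F F' => [|m IH] al h k; first by case: k.
case: (unliftP ord0 k) => {k}[k|] -> F F' h0 dF Fbe Fal /=; last first.
  pose G (i : nat) := @rsum R m N (fun k => al k.+1) (fun k => h k.+1)
        (fun v : 'rV[R]_m => F (row_mx ((al 0%N + i%:R * h 0%N)%:M : 'M[R]_1) v)).
  have := telescope_sumr G (leq0n N); rewrite big_mkord => teleG.
  (* The signs on the two faces give [G N >= 0 >= G 0], so the telescoped sum is nonnegative. *)
  apply: (@le_trans _ _ (\sum_(i < N) (G i.+1 - G i))).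
    rewrite teleG subr_ge0; apply: (@le_trans _ _ 0).
      rewrite -oppr_ge0 -mulN1r -rsumZ; apply: rsum_ge0 => // z bz.
      rewrite mulN1r oppr_ge0 mul0r addr0; apply: Fal.
        by apply/gridbox_cons; split => //; rewrite lexx lerDl mulr_ge0.
      by rewrite row_mx_cons0.
    apply: rsum_ge0 => // z bz; apply: Fbe.
      by apply/gridbox_cons; split => //; rewrite lexx lerDl mulr_ge0.
    by rewrite row_mx_cons0.
  apply: ler_sum => i _; rewrite -rsumB -rsumZ; apply: rsum_le => // v bv.
  have e : al 0%N + i.+1%:R * h 0%N = h 0%N + (al 0%N + i%:R * h 0%N).
    by rewrite -natr1; ring.
  rewrite e -add_delta_row0; apply: dF.
    by apply/gridbox_cons; split => //; apply: grid_node => //; apply/ltnW.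
  by rewrite row_mx_cons0 -e lerD2l ler_wpM2r// ler_nat.
(* If [k] is not the first axis, the induction hypothesis applies to each slice. *)
apply: sumr_ge0 => i _; apply: mulr_ge0 => //.
have bi v : gridbox N (fun k => al k.+1) (fun k => h k.+1) v ->
    gridbox (m := m.+1) N al h (row_mx ((al 0%N + i%:R * h 0%N)%:M : 'M[R]_1) v).
  by move=> bv; apply/gridbox_cons; split => //; apply: grid_node => //; apply/ltnW.
apply: (IH _ _ k (fun v => F (row_mx ((al 0%N + i%:R * h 0%N)%:M : 'M[R]_1) v))) => //.
- move=> v /bi bv hv; rewrite -add_delta_rowS; apply: dF => //.
  by rewrite row_mx_consS.
- by move=> v /bi bv hv; apply: Fbe => //; rewrite row_mx_consS.
- by move=> v /bi bv hv; apply: Fal => //; rewrite row_mx_consS.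
Qed.

Import HBNNSimple.

(* [G] need not be measurable: the integral of a nonnegative function is a
   supremum over the simple functions below it. *)
Lemma step_le_integral N (a b : R) (c : nat -> R) (G : R -> \bar R) :
  0 <= b -> (forall i, 0 <= c i) -> (forall t, (0 <= G t)%E) ->
  (forall (i : 'I_N) (t : R), a + i%:R * b <= t < a + i.+1%:R * b -> ((c i)%:E <= G t)%E) ->
  ((\sum_(i < N) b * c i)%:E <= \int[@lebesgue_measure R]_t G t)%E.
Proof.
move=> b0 c0 G0 cG.
pose I (i : nat) : set R := `[a + i%:R * b, a + i.+1%:R * b[%classic.
pose f (i : 'I_N) (t : R) : \bar R := (c i * \1_(I i) t)%:E.
have mI i : measurable (I i) by exact: measurable_itv.
have mf i : @measurable_fun _ _ (measurableTypeR R) _ setT (f i).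
  rewrite /f; apply/measurable_EFinP => /=; apply: measurable_funM => //.
  apply: (@measurable_indic _ (measurableTypeR R) R); exact: mI.
have f0 i t : (0 <= f i t)%E.
  by rewrite lee_fin mulr_ge0// indicE.
have -> : ((\sum_(i < N) b * c i)%:E = \int[@lebesgue_measure R]_t (\sum_(i < N) f i t))%E.
  rewrite ge0_integral_sum//= -sumEFin; apply: eq_bigr => i _.
  transitivity ((c i)%:E * \int[@lebesgue_measure R]_t (\1_(I i) t)%:E)%E.
    rewrite integral_indic; [|exact: measurableT|exact: mI].
    rewrite setIT [X in (_ * X)%E]lebesgue_measure_itv/= lte_fin -EFinB.
    rewrite -natr1 mulrDl mul1r addrA.
    case: ifPn => [_|]; first by rewrite -EFinM; congr _%:E; ring.
    by rewrite -leNgt gerDl => b0'; rewrite (le_anti (introT andP (conj b0' b0))) mul0r mule0.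
  rewrite -ge0_integralZl//= ?lee_fin//.
  by apply/measurable_EFinP; apply: (@measurable_indic _ (measurableTypeR R) R); exact: mI.
rewrite !ge0_integralTE//; last by move=> t; apply: sume_ge0.
apply: ge_ereal_sup => _ [g/= gS <-]; apply: le_ereal_sup_tmp.
exists (sintegral lebesgue_measure g) => //; exists g => // t.
apply: (le_trans (gS t)).
have [[i ti]|noI] := pselect (exists i : 'I_N, I i t).
  rewrite (bigD1 i)//= big1 ?addr0 => [|j ji]; rewrite /f indicE.
    by rewrite mem_set// mulr1; apply: (cG i); move: ti; rewrite /I/= in_itv.
  rewrite memNset ?mulr0// /I/= in_itv/= => /andP[tj1 tj2].
  move: ti; rewrite /I/= in_itv/= => /andP[ti1 ti2].
  (* The cells are half-open, hence disjoint: at most one term of the step function is nonzero at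
     [t]. *)
  have lt_of (p q : nat) : a + p%:R * b <= t -> t < a + q.+1%:R * b -> (p <= q)%N.
    move=> tp tq; rewrite leqNgt; apply/negP => qp.
    have := lt_le_trans tq (le_trans _ tp); rewrite ltxx => /(_ _)/negP; apply => //.
    by rewrite lerD2l ler_wpM2r// ler_nat.
  by move/eqP: ji; apply; apply/val_inj/eqP; rewrite eqn_leq !lt_of.
rewrite big1// => i _; rewrite /f indicE memNset ?mulr0// => Iit.
by apply: noI; exists i.
Qed.

Lemma iint_ge0 m (g : 'rV[R]_m -> \bar R) : (forall z, (0 <= g z)%E) -> (0 <= iint g)%E.
Proof.
elim: m g => [|m IH] g g0 /=; first exact: g0.
by apply: integral_ge0 => t _; apply: IH.
Qed.

(** On each cell, [f] at the lower corner [z] has to lie below [g] at every point [z']. As [z]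
    ranges over the whole box and not only over nodes, the last bound on [z'] keeps it inside the
    box. *)
Lemma rsum_le_iint m N al h (f : 'rV[R]_m -> R) (g : 'rV[R]_m -> \bar R) :
  (forall k, 0 <= h k) -> (forall z, 0 <= f z) -> (forall z, (0 <= g z)%E) ->
  (forall z z' : 'rV[R]_m, gridbox N al h z ->
     (forall k : 'I_m, z 0 k <= z' 0 k <= z 0 k + h k) ->
     (forall k : 'I_m, z' 0 k <= al k + N%:R * h k) -> ((f z)%:E <= g z')%E) ->
  ((rsum N al h f)%:E <= iint g)%E.
Proof.
elim: m al h f g => [|m IH] al h f g h0 f0 g0 fg /=.
  by apply: fg => -[].
apply: (@step_le_integral N (al 0%N) (h 0%N) (fun i =>
   rsum N (fun k => al k.+1) (fun k => h k.+1)
        (fun v : 'rV[R]_m => f (row_mx ((al 0%N + i%:R * h 0%N)%:M : 'M[R]_1) v)))) => //.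
- by move=> i; apply: rsum_ge0.
- by move=> t; apply: iint_ge0.
move=> i t /andP[it ti]; apply: IH => // z z' bz zz' z'b; apply: fg.
- by apply/gridbox_cons; split => //; apply: grid_node => //; apply/ltnW.
- apply: forall_ordS => [|k]; rewrite ?row_mx_cons0 ?row_mx_consS//.
  rewrite it /= (le_trans (ltW ti))// -natr1; lra.
- apply: forall_ordS => [|k]; rewrite ?row_mx_cons0 ?row_mx_consS//.
  by rewrite (le_trans (ltW ti))// lerD2l ler_wpM2r// ler_nat.
Qed.

End RiemannSum.

(** * The radial kernel *)

Section Kernel.
Context {R : realType}.

Lemma continuous_exprn (T : topologicalType) (f : T -> R) n x :
  {for x, continuous f} -> {for x, continuous (fun z => f z ^+ n)}.
Proof. by move=> cf; apply: (@continuous_comp _ _ _ f (fun y => y ^+ n)) => //; exact: exprn_continuous. Qed.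

(** Squaring removes the corner of the positive part at 0, which is why the cutoff enters the kernel
    squared. *)
Lemma is_derive_maxr0_sqr (x : R) :
  is_derive x 1 (fun u => Num.max 0 u ^+ 2) (2 * Num.max 0 x).
Proof.
have [x0|x0|<-] := ltgtP 0 x.
- apply: (near_eq_is_derive (f := fun u : R => u ^+ 2)).
    near=> u; have u0 : 0 <= u by apply: ltW; near: u; exact: lt_nbhsr.
    by rewrite (max_r u0).
  by apply: is_derive_eq; rewrite /GRing.scale /= mulr1 mulr_natl.
- rewrite mulr0; apply: (near_eq_is_derive (f := fun u : R => 0)).
  near=> u; have u0 : u <= 0 by apply: ltW; near: u; exact: lt_nbhsl.
  by rewrite (max_l u0) expr0n.
- apply/is_derive1_caratheodory; exists (fun z => Num.max 0 z); split.
  + move=> z; rewrite maxxx subr0 expr0n subr0 expr2.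
    by have [z0|z0] := leP 0 z; rewrite ?mul0r.
  + by apply: continuous_max => //; exact: cst_continuous.
  + by rewrite maxxx mulr0.
Unshelve. all: by end_near. Qed.

(** The primitive is the integral from [a], so it is controlled only to the right of [a]; with
    [a = -1] this covers all squared distances. *)
Lemma continuous_primitive (f : R -> R) (a : R) : continuous f ->
  exists F, forall x, a < x -> is_derive x 1 F (f x).
Proof.
move=> cf; exists (fun x => \int[@lebesgue_measure R]_(t in `[a, x]) f t)%R.
move=> x ax; have xx1 : x < x + 1 by rewrite ltrDl.
have fi : (@lebesgue_measure R).-integrable `[a, x + 1] (EFin \o f).
  by apply: continuous_compact_integrable; [exact: segment_compact|exact: continuous_subspaceT].
have [dF F'] := @continuous_FTC1_closed R f a x (x + 1) xx1 fi ax (cf x).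
by apply: DeriveDef => //; rewrite -derive1E.
Qed.

Lemma MVT_is_derive (f df : R -> R) (a b : R) : a <= b ->
  (forall x : R, a <= x <= b -> is_derive x 1 f (df x)) ->
  exists2 c, a <= c <= b & f b - f a = df c * (b - a).
Proof.
move=> ab fdf; have [||c cab E] := @MVT_segment R f df a b ab.
- by move=> x; rewrite in_itv/= => /andP[ax xb]; apply: fdf; rewrite !ltW.
- apply: derivable_within_continuous => x; rewrite in_itv/= => xab.
  by have [] := fdf x xab.
- by exists c => //; move: cab; rewrite in_itv.
Qed.

Variables (n : nat) (l rho : R).
Hypotheses (n0 : (0 < n)%N) (l0 : 0 < l) (rho0 : 0 < rho).

(* [kw q] is [(q^2 + rho^4)^(-n/4)], written so that it differentiates easily. *)
Let kden (q : R) : R := q ^+ 2 + rho ^+ 4.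
Let kroot (q : R) : R := expR (ln (kden q) / 4).
Let kw (q : R) : R := expR (- (n%:R / 4) * ln (kden q)).
Let kp (q : R) : R := Num.max 0 (1 - (q / l ^+ 2) ^+ n).
Let kw' (q : R) : R := kw q * (- (n%:R / 4) * (2 * q / kden q)).
Let kchi' (q : R) : R := 2 * kp q * - (n%:R * q ^+ n.-1 / (l ^+ 2) ^+ n).
(** [kg1] and [kg2] are the first and second derivatives of the kernel; the kernel itself is
    obtained later by integrating [kg1]. *)
Let kg1 (q : R) : R := - (kw q * kp q ^+ 2).
Let kg2 (q : R) : R := - (kw' q * kp q ^+ 2 + kw q * kchi' q).

Let kden_gt0 q : 0 < kden q.
Proof. by rewrite /kden ltr_wpDl ?sqr_ge0// exprn_gt0. Qed.

Let is_derive_kden (q : R) : is_derive q 1 kden (2 * q).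
Proof. by rewrite /kden; apply: is_derive_eq; rewrite scaler1 addr0 mulr_natl. Qed.

Let is_derive_kw (q : R) : is_derive q 1 kw (kw' q).
Proof.
have d1 := is_derive1_comp (is_derive1_ln (kden_gt0 q)) (is_derive_kden q).
have d2 := @is_deriveZ _ _ _ _ (- (n%:R / 4)) q 1 _ d1.
have := is_derive1_comp (is_derive_expR _) d2.
by move=> h; apply: (is_derive_eq h); rewrite /kw' /kw /= /GRing.scale /=; field; rewrite gt_eqF.
Qed.

Let is_derive_kp2 (q : R) : is_derive q 1 (fun q => kp q ^+ 2) (kchi' q).
Proof.
have d1 : is_derive q 1 (fun q => 1 - (q / l ^+ 2) ^+ n) (- (n%:R * q ^+ n.-1 / (l ^+ 2) ^+ n)).
  have d : is_derive q 1 (fun q => q / l ^+ 2) ((l ^+ 2)^-1).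
    have -> : (fun q => q / l ^+ 2) = ((l ^+ 2)^-1 \*: (id : R -> R)).
      by apply/funext => x; rewrite /= mulrC.
    by apply: is_derive_eq; rewrite /GRing.scale/= mulr1.
  have h := is_deriveB (is_derive_cst (1 : R) q 1) (is_deriveX n d).
  have -> : (fun q => 1 - (q / l ^+ 2) ^+ n) =
      cst (1 : R) - (fun q => q / l ^+ 2) ^+ n by rewrite exprfctE.
  have E : (l ^+ 2) ^+ n = l ^+ 2 * (l ^+ 2) ^+ n.-1 by rewrite -exprS prednK.
  apply: (is_derive_eq h); rewrite /GRing.scale/= E exprMn exprVn.
  rewrite [(l ^+ 2 * _)^-1]invfM; move: ((l ^+ 2) ^- n.-1) (l ^- 2) => X Y; ring.
exact: (is_derive1_comp (is_derive_maxr0_sqr _) d1).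
Qed.

Let is_derive_kg1 (q : R) : is_derive q 1 kg1 (kg2 q).
Proof.
rewrite /kg1 /kg2; apply: is_deriveN.
have := is_deriveM (is_derive_kw q) (is_derive_kp2 q).
by move=> h; apply: (is_derive_eq h); rewrite /GRing.scale/= [RHS]addrC [X in _ + X]mulrC.
Qed.

Let is_derive1_continuous (f df : R -> R) :
  (forall x : R, is_derive x 1 f (df x)) -> continuous f.
Proof.
by move=> fdf x; apply/differentiable_continuous/derivable1_diffP; have [] := fdf x.
Qed.

Let continuous_kp : continuous kp.
Proof.
move=> q; apply: (@continuous_max _ R (cst 0) (fun q : R => 1 - (q / l ^+ 2) ^+ n) q).
  exact: cst_continuous.
apply: continuousB; first exact: cst_continuous.
apply: continuous_exprn; apply: continuousM; first exact: cvg_id.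
exact: cst_continuous.
Qed.

Let continuous_kg2 : continuous kg2.
Proof.
have cw := is_derive1_continuous is_derive_kw.
have cp := is_derive1_continuous is_derive_kp2.
have cd := is_derive1_continuous is_derive_kden.
have cn : continuous (fun q : R => q ^+ n.-1).
  by move=> q; apply: continuous_exprn; exact: cvg_id.
have ck q : {for q, continuous (fun q : R => n%:R * q ^+ n.-1 / (l ^+ 2) ^+ n)}.
  apply: continuousM; last exact: cst_continuous.
  by apply: continuousM; [exact: cst_continuous|exact: cn].
have cX q : {for q, continuous (fun q => kw' q * kp q ^+ 2 + kw q * kchi' q)}.
  apply: continuousD; apply: continuousM.
  - apply: continuousM; first exact: cw.
    apply: continuousM; first exact: cst_continuous.
    apply: continuousM; first by apply: continuousM; [exact: cst_continuous|exact: cvg_id].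
    by apply: continuousV; [rewrite gt_eqF|exact: cd].
  - exact: cp.
  - exact: cw.
  - apply: continuousM; last exact: (continuousN (ck q)).
    by apply: continuousM; [exact: cst_continuous|exact: continuous_kp].
by move=> q; exact: (continuousN (cX q)).
Qed.

Let kroot_gt0 q : 0 < kroot q. Proof. exact: expR_gt0. Qed.

Let kroot4 q : kroot q ^+ 4 = kden q.
Proof.
by rewrite /kroot -expRM_natl mulrC divfK ?pnatr_eq0// lnK// posrE.
Qed.

Let kwE q : kw q = (kroot q ^+ n)^-1.
Proof. by rewrite /kw /kroot -expRM_natl -expRN; congr expR; field. Qed.

Let kw_gt0 q : 0 < kw q. Proof. exact: expR_gt0. Qed.

Let kp_ge0 q : 0 <= kp q. Proof. by rewrite /kp le_max lexx. Qed.

Let kp_le1 (q : R) : 0 <= q -> kp q <= 1.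
Proof.
move=> q0; rewrite /kp ge_max ler01 gerBl.
by rewrite exprn_ge0// divr_ge0// sqr_ge0.
Qed.

Let kp_eq0 q : l ^+ 2 <= q -> kp q = 0.
Proof.
move=> lq; apply: max_l; rewrite subr_le0 exprn_ege1//.
by rewrite ler_pdivlMr ?mul1r// exprn_gt0.
Qed.

(** Amounts to [q <= kroot q * l], whose fourth power is [q^2 * q^2 <= kden q * l^4]. *)
Let kw_qn (q : R) : 0 <= q -> q <= l ^+ 2 -> kw q * q ^+ n <= l ^+ n.
Proof.
move=> q0 ql; rewrite kwE mulrC ler_pdivrMr ?exprn_gt0// -exprMn.
have k0 := ltW (kroot_gt0 q); have l0' := ltW l0.
apply: lerXn2r; rewrite ?nnegrE ?mulr_ge0//.
rewrite -(@ler_pXn2r _ 4) ?nnegrE ?mulr_ge0//.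
rewrite exprMn kroot4 /kden.
have -> : q ^+ 4 = q ^+ 2 * q ^+ 2 by ring.
have -> : l ^+ 4 = (l ^+ 2) ^+ 2 by ring.
apply: ler_pM; rewrite ?sqr_ge0//; last by rewrite lerDl exprn_ge0 ?ltW.
by apply: lerXn2r; rewrite ?nnegrE ?sqr_ge0.
Qed.

(** The left-hand side is the sum of the pure second derivatives of [g(|z - c|^2)] at
    [q = |z - c|^2]. It would vanish for [g' = - q^(-n/2)], the fundamental solution; the first term
    on the right comes from the regularization by [rho], the second from the cutoff. *)
Let kg_identity q : 4 * q * kg2 q + 2 * n%:R * kg1 q =
  - (2 * n%:R * rho ^+ 4 * kw q * kp q ^+ 2 / kden q)
  + 8 * n%:R * (kw q * q ^+ n) * kp q / (l ^+ 2) ^+ n.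
Proof.
have kd : q ^+ 2 + rho ^+ 4 != 0 by rewrite gt_eqF// kden_gt0.
have -> : q ^+ n = q * q ^+ n.-1 by rewrite -exprS prednK.
rewrite /kg1 /kg2 /kw' /kchi' /kden.
by move: (kw q) (kp q) (q ^+ n.-1) ((l ^+ 2) ^- n) => w p qn L; field.
Qed.

Lemma exists_kernel : exists g g1 g2 : R -> R,
  [/\ forall q : R, -1 < q -> is_derive q 1 g (g1 q),
      forall q : R, is_derive q 1 g1 (g2 q),
      continuous g2,
      forall q : R, l ^+ 2 <= q -> g q = 0 /\ g1 q = 0 &
   [/\ forall q : R, 0 <= q -> 0 <= g q,
      forall q : R, 0 <= q -> 4 * q * g2 q + 2 * n%:R * g1 q <= 8 * n%:R / l ^+ n &
      forall q : R, 0 <= q -> q <= rho ^+ 2 -> 2 * rho ^+ 2 <= l ^+ 2 ->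
        4 * q * g2 q + 2 * n%:R * g1 q <=
        8 * n%:R / l ^+ n - n%:R / 4 / (2 * rho) ^+ n]].
Proof.
have [F dF] := continuous_primitive (-1) (is_derive1_continuous is_derive_kg1).
have L0 : -1 < l ^+ 2 by rewrite (lt_le_trans _ (sqr_ge0 _))// ltrN10.
(* The cutoff term is of size [l^-n]: by [kw_qn] it is at most [8 n l^n / l^(2n)] where [kp] is
   nonzero. *)
have P2 q : 0 <= q ->
    8 * n%:R * (kw q * q ^+ n) * kp q / (l ^+ 2) ^+ n <= 8 * n%:R / l ^+ n.
  move=> q0; have [ql|lq] := leP q (l ^+ 2); last first.
    by rewrite (kp_eq0 (ltW lq)) mulr0 mul0r divr_ge0// ?exprn_ge0 ?mulr_ge0// ltW.
  have -> : 8 * n%:R / l ^+ n = 8 * n%:R * l ^+ n / (l ^+ 2) ^+ n.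
    by rewrite -exprM mulnC exprM; field; rewrite gt_eqF ?exprn_gt0.
  rewrite ler_pM2r ?invr_gt0 ?exprn_gt0//.
  have w0 := ltW (kw_gt0 q); rewrite -[leRHS]mulr1; apply: ler_pM.
  - by rewrite !mulr_ge0 ?exprn_ge0.
  - exact: kp_ge0.
  - by rewrite ler_wpM2l ?mulr_ge0 ?kw_qn.
  - exact: kp_le1.
have kg10 q : l ^+ 2 <= q -> kg1 q = 0.
  by move=> lq; rewrite /kg1 kp_eq0// expr0n mulr0 oppr0.
have gout q : l ^+ 2 <= q -> F q - F (l ^+ 2) = 0.
  move=> lq; have [|c /andP[lc _] ->] := @MVT_is_derive F kg1 _ _ lq.
    by move=> x /andP[lx _]; apply: dF; exact: lt_le_trans lx.
  by rewrite kg10// mul0r.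
(* The constant is fixed so that the kernel vanishes for [q >= l^2]. As [kg1 <= 0], it decreases to
   0 there and is therefore nonnegative for [q >= 0]. *)
exists (fun q => F q - F (l ^+ 2)), kg1, kg2; split.
- move=> q q1; have := is_deriveB (dF q q1) (is_derive_cst (F (l ^+ 2)) q 1).
  by move=> h; apply: (is_derive_eq h); rewrite subr0.
- exact: is_derive_kg1.
- exact: continuous_kg2.
- by move=> q lq; rewrite kg10// gout.
split.
- move=> q q0; have [ql|lq] := leP q (l ^+ 2); last by rewrite (gout _ (ltW lq)).
  have [|c _ E] := @MVT_is_derive F kg1 _ _ ql.
    by move=> x /andP[lx _]; apply: dF; rewrite (lt_le_trans _ lx)// (lt_le_trans _ q0)// ltrN10.
  rewrite -opprB E oppr_ge0 mulr_le0_ge0 ?subr_ge0// /kg1 oppr_le0.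
  by rewrite mulr_ge0 ?sqr_ge0// ltW.
- move=> q q0; rewrite kg_identity -[leRHS]add0r; apply: lerD; last exact: P2.
  have w0 := ltW (kw_gt0 q); have r0 := ltW rho0; have d0 := ltW (kden_gt0 q).
  by rewrite oppr_le0 divr_ge0// !mulr_ge0 ?sqr_ge0 ?exprn_ge0.
- move=> q q0 qr rl; rewrite kg_identity addrC; apply: lerD; first exact: P2.
  have rho0' := ltW rho0; have q2 : q ^+ 2 <= rho ^+ 4.
    have -> : rho ^+ 4 = (rho ^+ 2) ^+ 2 by ring.
    by apply: lerXn2r; rewrite ?nnegrE ?sqr_ge0.
  (* For [q <= rho^2] the regularization term is estimated with [kw >= (2 rho)^-n], [kp >= 1/2] and
     [kden <= 2 rho^4], which leaves at least [(n/4) (2 rho)^-n]. *)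
  have wlow : ((2 * rho) ^+ n)^-1 <= kw q.
    rewrite kwE lef_pV2 ?posrE ?exprn_gt0 ?mulr_gt0//.
    have k0 := ltW (kroot_gt0 q).
    apply: lerXn2r; rewrite ?nnegrE ?mulr_ge0//.
    rewrite -(@ler_pXn2r _ 4) ?nnegrE ?mulr_ge0// kroot4 /kden exprMn.
    have := exprn_ge0 4 rho0'; lra.
  have plow : 1 / 2 <= kp q.
    rewrite /kp le_max; apply/orP; right.
    have ql0 : 0 <= q / l ^+ 2 by rewrite divr_ge0 ?sqr_ge0.
    have ql : q / l ^+ 2 <= 1 / 2 by rewrite ler_pdivrMr ?exprn_gt0//; lra.
    have : (q / l ^+ 2) ^+ n <= q / l ^+ 2.
      by rewrite -[leRHS]expr1 ler_wiXn2l//; lra.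
    lra.
  rewrite lerN2 ler_pdivlMr ?kden_gt0//.
  have kd : kden q <= 2 * rho ^+ 4 by rewrite /kden; lra.
  apply: (@le_trans _ _ (2 * n%:R * rho ^+ 4 * ((2 * rho) ^+ n)^-1 * (1 / 2) ^+ 2)).
    have -> : 2 * n%:R * rho ^+ 4 * ((2 * rho) ^+ n)^-1 * (1 / 2) ^+ 2 =
      n%:R / 4 / (2 * rho) ^+ n * (2 * rho ^+ 4).
      by move: ((2 * rho) ^- n) => W; field.
    by rewrite ler_wpM2l// !mulr_ge0 ?invr_ge0 ?exprn_ge0 ?mulr_ge0.
  apply: ler_pM; rewrite ?sqr_ge0//.
  - by rewrite !mulr_ge0 ?invr_ge0 ?exprn_ge0 ?mulr_ge0.
  - by rewrite ler_wpM2l// !mulr_ge0 ?exprn_ge0.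
  - by apply: lerXn2r => //; rewrite ?nnegrE//; lra.
Qed.

End Kernel.

(** * Partial derivatives as one-variable derivatives along coordinate lines *)

Definition pder {R : realType} {n} (k : 'I_n) (F : 'rV[R]_n -> R) (x : 'rV[R]_n) (d : R) :=
  is_derive (0 : R) 1 (fun t : R => F (t *: delta_mx 0 k + x)) d.

Definition sqdist {R : realType} {n} (c z : 'rV[R]_n) : R :=
  \sum_(k < n) (z 0 k - c 0 k) ^+ 2.

Section LineDerivatives.
Context {R : realType} {n : nat}.
Implicit Types (k : 'I_n) (F G : 'rV[R]_n -> R) (x z c : 'rV[R]_n).

Lemma delta_lineE k (t : R) x j :
  (t *: delta_mx 0 k + x) 0 j = (if j == k then t else 0) + x 0 j.
Proof. by rewrite !mxE eqxx /=; case: eqP; rewrite ?mulr1 ?mulr0. Qed.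

Lemma pder_partial k F x : differentiable F x -> pder k F x (partial k F x).
Proof.
move=> dF.
have E : (fun h : R => h^-1 *: ((F \o shift x) (h *: delta_mx 0 k) - F x)) =
  (fun h : R => h^-1 *: (((fun t : R => F (t *: delta_mx 0 k + x)) \o shift 0) (h *: 1)
     - F (0 *: delta_mx 0 k + x))).
  by apply/funext => h /=; rewrite scale0r add0r addr0 [h *: 1]mulr1.
apply: DeriveDef.
  by have := @diff_derivable _ _ _ F x (delta_mx 0 k) dF; rewrite /derivable E.
by rewrite /partial /derive E.
Qed.

Lemma pder_eq k F x d d' : pder k F x d -> d = d' -> pder k F x d'.
Proof. by move=> h <-. Qed.

Lemma pderM k F G x f g : pder k F x f -> pder k G x g ->
  pder k (fun z => F z * G z) x (F x * g + G x * f).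
Proof.
move=> dF dG; apply: (is_derive_eq (is_deriveM dF dG)).
by rewrite scale0r add0r.
Qed.

Lemma pderD k F G x f g : pder k F x f -> pder k G x g ->
  pder k (fun z => F z + G z) x (f + g).
Proof. by move=> dF dG; exact: is_deriveD. Qed.

Lemma pderB k F G x f g : pder k F x f -> pder k G x g ->
  pder k (fun z => F z - G z) x (f - g).
Proof. by move=> dF dG; exact: is_deriveB. Qed.

Lemma pder_cst k (a : R) x : pder k (fun=> a) x 0.
Proof. exact: is_derive_cst. Qed.

Lemma pder_coord k j x : pder k (fun z => z 0 j) x (j == k)%:R.
Proof.
rewrite /pder; have -> : (fun t : R => (t *: delta_mx 0 k + x) 0 j) =
    (fun t : R => (j == k)%:R * t + x 0 j).
  by apply/funext => t; rewrite delta_lineE; case: eqP; rewrite ?mul1r ?mul0r.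
have h := is_deriveD (is_deriveZ (j == k)%:R (is_derive_id (0 : R) 1)) (is_derive_cst (x 0 j) (0 : R) 1).
by apply: (is_derive_eq h); rewrite addr0 [_ *: _]mulr1.
Qed.

Lemma sqdist_line c k (t : R) z :
  sqdist c (t *: delta_mx 0 k + z) = t ^+ 2 + 2 * (z 0 k - c 0 k) * t + sqdist c z.
Proof.
rewrite /sqdist (bigD1 k)//= [in RHS](bigD1 k)//= delta_lineE eqxx addrA.
congr (_ + _); first by ring.
by apply: eq_bigr => j jk; rewrite delta_lineE (negbTE jk) add0r.
Qed.

Lemma sqdist_ge0 c z : 0 <= sqdist c z.
Proof. by apply: sumr_ge0 => k _; exact: sqr_ge0. Qed.

Lemma sqr_le_sqdist c z k : (z 0 k - c 0 k) ^+ 2 <= sqdist c z.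
Proof.
by rewrite /sqdist (bigD1 k)//= lerDl; apply: sumr_ge0 => j _; exact: sqr_ge0.
Qed.

Lemma pder_sqdist k c z (g : R -> R) (d : R) : is_derive (sqdist c z) 1 g d ->
  pder k (fun z => g (sqdist c z)) z (d * (2 * (z 0 k - c 0 k))).
Proof.
move=> dg; rewrite /pder.
have dq : is_derive (0 : R) 1 (fun t : R => sqdist c (t *: delta_mx 0 k + z))
    (2 * (z 0 k - c 0 k)).
  have -> : (fun t : R => sqdist c (t *: delta_mx 0 k + z)) =
     (id : R -> R) * id + (2 * (z 0 k - c 0 k)) \*: (id : R -> R) + cst (sqdist c z).
    by apply/funext => t; rewrite sqdist_line.
  have h := is_deriveD (is_deriveD (is_deriveM (is_derive_id (0 : R) 1) (is_derive_id (0 : R) 1))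
     (is_deriveZ (2 * (z 0 k - c 0 k)) (is_derive_id (0 : R) 1))) (is_derive_cst (sqdist c z) (0 : R) 1).
  by apply: (is_derive_eq h); rewrite /GRing.scale/=; ring.
apply: is_derive1_comp dq => /=.
by rewrite scale0r add0r.
Qed.

Lemma pder_MVT k F (F' : 'rV[R]_n -> R) z (h : R) : 0 <= h ->
  (forall t : R, 0 <= t <= h -> pder k F (t *: delta_mx 0 k + z) (F' (t *: delta_mx 0 k + z))) ->
  exists2 t : R, 0 <= t <= h & F (h *: delta_mx 0 k + z) - F z = h * F' (t *: delta_mx 0 k + z).
Proof.
move=> h0 dF.
have [t th|t th E] := @MVT_is_derive R (fun t => F (t *: delta_mx 0 k + z))
  (fun t => F' (t *: delta_mx 0 k + z)) 0 h h0; last first.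
  by exists t => //; rewrite mulrC -[h in _ * h]subr0 -E scale0r add0r.
have /= d0 := dF t th; rewrite /pder in d0.
(* [pder] differentiates at parameter 0; composition with [s - t] moves the base point to parameter
   [t]. *)
have ds : is_derive t 1 (fun s : R => s - t) 1.
  have := is_deriveB (is_derive_id t 1) (is_derive_cst t t 1).
  by move=> ?; apply: is_derive_eq; rewrite subr0.
rewrite -[0](subrr t) in d0.
have := @is_derive1_comp R (fun s : R => F (s *: delta_mx 0 k + (t *: delta_mx 0 k + z)))
  (fun s : R => s - t) t _ _ d0 ds; rewrite mulr1.
congr is_derive; apply/funext => s /=.
by rewrite addrA -scalerDl subrK.
Qed.

(** Only [x] has to lie in [K]: [F] is continuous at points of [K] with respect to the full space,
    and the near-covering form of compactness makes the radius uniform. *)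
Lemma uniform_continuous_on (K : set 'rV[R]_n) F (eps : R) : compact K ->
  (forall x, K x -> {for x, continuous F}) -> 0 < eps ->
  exists2 del : R, 0 < del & forall x y : 'rV[R]_n, K x ->
    (forall k, `|x 0 k - y 0 k| < del) -> `|F x - F y| < eps.
Proof.
move=> cK cF e0.
have : \forall d \near (0 : R)^'+, K `<=` [set x : 'rV[R]_n | forall y : 'rV[R]_n,
    (forall k, `|x 0 k - y 0 k| < d) -> `|F x - F y| < eps].
  apply: (compact_near_coveringP _).1 => // x Kx.
  have e2 : 0 < eps / 2 by rewrite divr_gt0.
  have := cF x Kx; move/cvgrPdist_lt => /(_ _ e2)/nbhs_ballP[r /= r0 xr].
  have r2 : 0 < r / 2 by rewrite divr_gt0.
  exists (ball x (r / 2), [set d | 0 < d < r / 2]).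
    split; first exact: nbhsx_ballx.
    near=> d => /=; apply/andP; split; [near: d; exact: nbhs_right_gt|].
    by near: d; exact: nbhs_right_lt.
  move=> [z d] [/= [_ xz]] /andP[d0 dr] y zy.
  have xz' j : `|x 0 j - z 0 j| < r / 2 by exact: xz.
  have xy : ball x r y.
    split=> // i j; rewrite ord1; have := xz' j; have := zy j.
    rewrite /ball/= => a b; rewrite -(subrK (z 0 j) (x 0 j)) -addrA.
    by apply: le_lt_trans (ler_normD _ _) _; lra.
  have xz2 : ball x r z.
    by split=> // i j; rewrite ord1 /ball/=; apply: lt_trans (xz' j) _; lra.
  have := xr _ xy; have := xr _ xz2; rewrite /= => a b.
  rewrite -(subrK (F x) (F z)) -addrA.
  apply: le_lt_trans (ler_normD _ _) _; rewrite distrC; lra.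
move=> nd; near (0 : R)^'+ => d; exists d; first by near: d; exact: nbhs_right_gt.
have Kd : K `<=` [set x : 'rV[R]_n | forall y : 'rV[R]_n,
    (forall k, `|x 0 k - y 0 k| < d) -> `|F x - F y| < eps] by near: d.
by move=> x y Kx; exact: (Kd x Kx).
Unshelve. all: by end_near. Qed.

End LineDerivatives.

(** * Fine Riemann sums on a box: divergence and comparison with the integral *)

Section Mesh.
Context {R : realType} {n : nat}.
Variables (al be : nat -> R).
Hypothesis albe : forall k, al k <= be k.
Implicit Types (F e : 'rV[R]_n -> R).

Definition box : set 'rV[R]_n := [set z | forall k : 'I_n, al k <= z 0 k <= be k].

Definition mesh (N : nat) (k : nat) : R := (be k - al k) / N%:R.

Definition boxvol : R := \prod_(k < n) (be k - al k).

Lemma compact_box : compact box.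
Proof.
have := @rV_compact R n (fun k => `[al k, be k]%classic) (fun k => @segment_compact _ _ _).
congr compact; apply/seteqP; split=> z /= bz k; have := bz k; rewrite in_itv//.
Qed.

Lemma mesh_ge0 N k : 0 <= mesh N k.
Proof. by rewrite divr_ge0// subr_ge0. Qed.

Lemma mesh_end N k : (0 < N)%N -> al k + N%:R * mesh N k = be k.
Proof.
by move=> N0; rewrite /mesh mulrC divfK ?pnatr_eq0 ?gtn_eqF// addrC subrK.
Qed.

Lemma gridbox_box N z : (0 < N)%N -> gridbox N al (mesh N) z <-> box z.
Proof. by move=> N0; split=> bz k; have := bz k; rewrite mesh_end. Qed.

Lemma mesh_lt (del : R) : 0 < del -> \forall N \near \oo, (0 < N)%N /\ forall k : 'I_n, mesh N k < del.
Proof.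
move=> d0; near=> N; have N0 : (0 < N)%N by near: N; exact: nbhs_infty_gt.
split=> // k; rewrite /mesh ltr_pdivrMr ?ltr0n// -ltr_pdivrMl//.
apply: (@le_lt_trans _ _ (\sum_(j < n) (del^-1 * (be j - al j)))).
  rewrite (bigD1 k)//= lerDl; apply: sumr_ge0 => j _.
  by rewrite mulr_ge0 ?invr_ge0 ?subr_ge0// ltW.
near: N; exact: nbhs_infty_gtr.
Unshelve. all: by end_near. Qed.

Lemma rsum_mesh_cst N c : (0 < N)%N -> rsum N al (mesh N) (fun _ : 'rV[R]_n => c) = c * boxvol.
Proof.
move=> N0; rewrite rsum_cst; congr (_ * _); apply: eq_bigr => k _.
by rewrite /mesh mulrC divfK// pnatr_eq0 gtn_eqF.
Qed.

(** By the mean value theorem the increment of [F] across a cell is the step times [F'] at a point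
    of that cell, hence at most the step times [F' + eps] at the node once the mesh is fine;
    [rsum_div] then applies. *)
Lemma rsum_div_ge (k : 'I_n) F F' (eps : R) : 0 < eps ->
  (forall z, box z -> pder k F z (F' z)) ->
  (forall z, box z -> {for z, continuous F'}) ->
  (forall z, box z -> z 0 k = be k -> 0 <= F z) ->
  (forall z, box z -> z 0 k = al k -> F z <= 0) ->
  \forall N \near \oo, 0 <= rsum N al (mesh N) F' + eps * boxvol.
Proof.
move=> e0 dF cF' Fbe Fal.
have [del d0 uc] := uniform_continuous_on compact_box cF' e0.
near=> N; have [N0 Nd] : (0 < N)%N /\ forall k : 'I_n, mesh N k < del.
  by near: N; exact: mesh_lt.
rewrite -(rsum_mesh_cst _ N0) -rsumD; apply: (rsum_div (k := k) (F := F)).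
- by move=> j; exact: mesh_ge0.
- move=> z /gridbox_box bz; rewrite mesh_end// => zb.
  have bline t : 0 <= t <= mesh N k -> box (t *: delta_mx 0 k + z).
    move=> /andP[t0 th] j; rewrite delta_lineE; have := bz N0 j; case: eqP => [->|_].
      by move=> /andP[aj jb]; apply/andP; split; lra.
    by rewrite add0r.
  have [t t0 ->] := pder_MVT (mesh_ge0 N k) (fun t ht => dF _ (bline t ht)).
  rewrite ler_wpM2l ?mesh_ge0//.
  have : `|F' z - F' (t *: delta_mx 0 k + z)| < eps.
    apply: uc; first exact: bz.
    move=> j; rewrite delta_lineE; case: eqP => [_|_]; last by rewrite add0r subrr normr0.
    rewrite opprD addrCA subrr addr0 normrN; case/andP: t0 => t0 th.
    by rewrite ger0_norm// (le_lt_trans th).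
  rewrite distrC ltr_norml => /andP[_]; lra.
- by move=> z /gridbox_box bz; rewrite mesh_end//; apply: Fbe; exact: bz.
- by move=> z /gridbox_box bz; apply: Fal; exact: bz.
Unshelve. all: by end_near. Qed.

Lemma rsum_le_iint_mesh e (g : 'rV[R]_n -> \bar R) (eps : R) : 0 < eps ->
  (forall z, box z -> {for z, continuous e}) ->
  (forall z, (0 <= g z)%E) -> (forall z, box z -> ((e z)%:E <= g z)%E) ->
  \forall N \near \oo, ((rsum N al (mesh N) e - eps * boxvol)%:E <= iint g)%E.
Proof.
move=> e0 ce g0 eg.
have [del d0 uc] := uniform_continuous_on compact_box ce e0.
near=> N; have [N0 Nd] : (0 < N)%N /\ forall k : 'I_n, mesh N k < del.
  by near: N; exact: mesh_lt.
(* Lowering by [eps] puts the node value below [e] on the whole cell; the truncation at 0 supplies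
   the nonnegativity that [rsum_le_iint] asks for. *)
apply: (@le_trans _ _ (rsum N al (mesh N) (fun z => Num.max 0 (e z - eps)))%:E).
  rewrite lee_fin -(rsum_mesh_cst _ N0) -rsumB; apply: rsum_le => [k|z _].
    exact: mesh_ge0.
  by rewrite le_max lexx orbT.
apply: rsum_le_iint => // [k|z|z z' /(gridbox_box _ N0) bz zz' z'b].
- exact: mesh_ge0.
- by rewrite le_max lexx.
have bz' : box z'.
  move=> k; rewrite -(mesh_end k N0) z'b andbT.
  by have /andP[+ _] := bz k; have /andP[+ _] := zz' k => a b; exact: le_trans a.
have [le0|gt0] := leP (e z - eps) 0; first exact: g0.
apply: le_trans (eg z' bz'); rewrite lee_fin.
have : `|e z - e z'| < eps.
  apply: uc => // k; rewrite distrC ger0_norm.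
    have /andP[_ a] := zz' k; have := Nd k; lra.
  by rewrite subr_ge0; have /andP[] := zz' k.
rewrite ltr_norml => /andP[_]; lra.
Unshelve. all: by end_near. Qed.

End Mesh.

(** * Counting grid nodes in an interval *)

Section GridCount.
Context {R : realType}.

Lemma rsum_sum (m N p : nat) (al h : nat -> R) (F : 'I_p -> 'rV[R]_m -> R) :
  rsum N al h (fun z => \sum_(k < p) F k z) = \sum_(k < p) rsum N al h (F k).
Proof.
elim: m al h F => [|m IH] al h F //=.
rewrite exchange_big; apply: eq_bigr => i _ /=.
by rewrite IH mulr_sumr.
Qed.

(* The increments of [t |-> clip (t - x - h) to [0, d - h]] along the grid are
   at most [h], and vanish unless the left node lies in [x, x + d]. *)
Lemma grid_count_ge (N : nat) (a h x d : R) : 0 <= h -> a <= x -> x + d <= a + N%:R * h ->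
  d - h <= \sum_(i < N) h * (x <= a + i%:R * h <= x + d)%R%:R.
Proof.
move=> h0 ax xN.
have [dh|hd] := leP d h.
  apply: (@le_trans _ _ 0); first by rewrite subr_le0.
  by apply: sumr_ge0 => i _; rewrite mulr_ge0.
pose phi (t : R) := if t <= x + h then 0 else if t <= x + d then t - x - h else d - h.
have := telescope_sumr (fun i => phi (a + i%:R * h)) (leq0n N).
rewrite big_mkord mul0r addr0 => tele.
have phiN : phi (a + N%:R * h) = d - h.
  by rewrite /phi; case: leP => ?; [|case: leP => ?]; lra.
have phi0 : phi a = 0 by rewrite /phi ifT//; lra.
have -> : d - h = phi (a + N%:R * h) - phi a by rewrite phiN phi0 subr0.
rewrite -tele; apply: ler_sum => i _.
rewrite -natr1 mulrDl mul1r addrA; move: (a + i%:R * h) => t; rewrite /phi.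
case: (leP x t) => /= xt; last by rewrite mulr0 !ifT; lra.
case: (leP t (x + d)) => /= td; rewrite ?mulr1 ?mulr0;
  case: (leP (t + h) (x + h)) => ?; case: (leP t (x + h)) => ?;
  case: (leP (t + h) (x + d)) => ?; lra.
Qed.

End GridCount.

(* Coordinates indexed by [nat], with junk value 0 out of range. *)
Definition coord {R : realType} {n} (x : 'rV[R]_n) (k : nat) : R :=
  if insub k is Some j then x 0 j else 0.

Lemma coordE {R : realType} n (x : 'rV[R]_n) (k : 'I_n) : coord x k = x 0 k.
Proof. by rewrite /coord valK. Qed.

Lemma continuous_bigsum {R : realType} (T : topologicalType) p (F : 'I_p -> T -> R) z :
  (forall k, {for z, continuous (F k)}) ->
  {for z, continuous (fun z => \sum_(k < p) F k z)}.
Proof.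
move=> cF; have -> : (fun z => \sum_(k < p) F k z) = \sum_(k < p) F k by rewrite fct_sumE.
elim/big_ind: _ => // [|f g cf cg]; first exact: cst_continuous.
exact: continuousD.
Qed.

(** * Testing against the kernel and its mirror image *)

Definition mirror {R : realType} {n} (i0 : 'I_n) (x : 'rV[R]_n) : 'rV[R]_n :=
  \row_k (if k == i0 then - x 0 i0 else x 0 k).

Section MeanValue.
Context {R : realType} {n : nat}.
Variables (i0 : 'I_n) (i0E : i0 = 0%N :> nat) (x : 'rV[R]_n) (l : R).
Hypotheses (l0 : 0 < l) (x0 : 0 <= x 0 i0).

Let n0 : (0 < n)%N. Proof. by apply: leq_ltn_trans (ltn_ord i0). Qed.

(** Lower bounds of the sup-norm cube of radius [l] around [x], cut by the half-space in coordinate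
    0 only. *)
Definition mv_lo (k : nat) : R := if k == 0%N then Num.max 0 (coord x k - l) else coord x k - l.
Definition mv_up (k : nat) : R := coord x k + l.

Lemma mv_lo_up k : mv_lo k <= mv_up k.
Proof.
have hl := l0.
rewrite /mv_lo /mv_up; case: eqP => [->|_] /=; last by lra.
have : 0 <= coord x 0%N by rewrite -i0E coordE.
by rewrite ge_max; move=> ?; apply/andP; split; lra.
Qed.

Lemma mv_lo_le (k : 'I_n) : mv_lo k <= x 0 k.
Proof.
have hl := l0.
rewrite /mv_lo -coordE; case: eqP => [k0|_] /=; last by lra.
have : 0 <= coord x 0%N by rewrite -i0E coordE.
by rewrite k0 ge_max => ?; apply/andP; split; lra.
Qed.

Lemma mv_width k : mv_up k - mv_lo k <= 2 * l.
Proof.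
have hl := l0.
rewrite /mv_up /mv_lo; case: eqP => _ /=; last by lra.
have : coord x k - l <= Num.max 0 (coord x k - l) by rewrite le_max lexx orbT.
by lra.
Qed.

Lemma mv_vol_ge0 : 0 <= boxvol (n := n) mv_lo mv_up.
Proof. by apply: prodr_ge0 => k _; rewrite subr_ge0 mv_lo_up. Qed.

Lemma mv_vol_le : boxvol (n := n) mv_lo mv_up <= (2 * l) ^+ n.
Proof.
rewrite -[in leRHS](card_ord n) -prodr_const; apply: ler_prod => k _.
by rewrite subr_ge0 mv_lo_up mv_width.
Qed.

Local Notation xr := (mirror i0 x).

Section KernelSum.
Variables (g g1 g2 : R -> R).
Hypotheses (dg : forall q : R, -1 < q -> is_derive q 1 g (g1 q))
  (dg1 : forall q : R, is_derive q 1 g1 (g2 q)) (cg2 : continuous g2)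
  (gout : forall q : R, l ^+ 2 <= q -> g q = 0 /\ g1 q = 0)
  (g_ge0 : forall q : R, 0 <= q -> 0 <= g q).

Let Gam z := g (sqdist x z) + g (sqdist xr z).
Let G1 (k : 'I_n) z := g1 (sqdist x z) * (2 * (z 0 k - x 0 k)) +
  g1 (sqdist xr z) * (2 * (z 0 k - xr 0 k)).
Let H2 c (k : 'I_n) (z : 'rV[R]_n) := g1 (sqdist c z) * 2 +
  (2 * (z 0 k - c 0 k)) * (g2 (sqdist c z) * (2 * (z 0 k - c 0 k))).
Let G2 k z := H2 x k z + H2 xr k z.

Let sqN1 c (z : 'rV[R]_n) : -1 < sqdist c z.
Proof. by rewrite (lt_le_trans _ (sqdist_ge0 c z))// ltrN10. Qed.

Let pder_Gam k z : pder k Gam z (G1 k z).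
Proof. by apply: pderD; apply: pder_sqdist; exact: dg. Qed.

Let pder_G1 k z : pder k (G1 k) z (G2 k z).
Proof.
have d c : pder k (fun z => g1 (sqdist c z) * (2 * (z 0 k - c 0 k))) z (H2 c k z).
  have d1 := pder_sqdist k (dg1 (sqdist c z)).
  have d2 : pder k (fun z => 2 * (z 0 k - c 0 k)) z 2.
    have := pderM (pder_cst k 2 z) (pderB (pder_coord k k z) (pder_cst k (c 0 k) z)).
    by move=> h; apply: (pder_eq h); rewrite eqxx /=; ring.
  exact: pderM d1 d2.
exact: pderD (d x) (d xr).
Qed.

Let continuous_sqdist (c : 'rV[R]_n) : continuous (sqdist c).
Proof.
move=> z; apply: continuous_bigsum => k; apply: continuous_exprn; apply: continuousB; last exact: cst_continuous.
exact: coord_continuous.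
Qed.

Let continuous_comp_sqdist (c : 'rV[R]_n) (f : R -> R) : continuous f -> continuous (fun z => f (sqdist c z)).
Proof.
by move=> cf z; apply: (@continuous_comp _ _ _ (sqdist c) f); [exact: continuous_sqdist|exact: cf].
Qed.

Let continuous_g1 : continuous g1.
Proof.
by move=> q; apply/differentiable_continuous/derivable1_diffP; have [] := dg1 q.
Qed.

Let continuous_Gam : continuous Gam.
Proof.
have d c (z : 'rV[R]_n) : {for z, continuous (fun z => g (sqdist c z))}.
  apply: (@continuous_comp _ _ _ (sqdist c) g); first exact: continuous_sqdist.
  by apply/differentiable_continuous/derivable1_diffP; have [] := dg (sqN1 c z).
by move=> z; apply: continuousD; exact: d.
Qed.

Let continuous_G2 k : continuous (G2 k).
Proof.
have d c (z : 'rV[R]_n) : {for z, continuous (H2 c k)}.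
  have cz : {for z, continuous (fun z : 'rV[R]_n => 2 * (z 0 k - c 0 k))}.
    apply: continuousM; first exact: cst_continuous.
    by apply: continuousB; [exact: coord_continuous|exact: cst_continuous].
  apply: continuousD; apply: continuousM => //.
  - exact: continuous_comp_sqdist.
  - exact: cst_continuous.
  - apply: continuousM => //; exact: continuous_comp_sqdist.
by move=> z; apply: continuousD; exact: d.
Qed.

Let sum_G2 z : \sum_(k < n) G2 k z =
  (4 * sqdist x z * g2 (sqdist x z) + 2 * n%:R * g1 (sqdist x z)) +
  (4 * sqdist xr z * g2 (sqdist xr z) + 2 * n%:R * g1 (sqdist xr z)).
Proof.
have d c : \sum_(k < n) H2 c k z =
    4 * sqdist c z * g2 (sqdist c z) + 2 * n%:R * g1 (sqdist c z).
  rewrite /H2 big_split /= sumr_const card_ord addrC; congr (_ + _); last first.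
    by rewrite -mulr_natl; ring.
  rewrite [in RHS]/sqdist mulr_sumr mulr_suml; apply: eq_bigr => k _; ring.
by rewrite big_split /= !d.
Qed.

Let vanish k (z : 'rV[R]_n) : l ^+ 2 <= (z 0 k - x 0 k) ^+ 2 -> l ^+ 2 <= (z 0 k - xr 0 k) ^+ 2 ->
  Gam z = 0 /\ G1 k z = 0.
Proof.
move=> a b.
have [ga g1a] := gout (le_trans a (sqr_le_sqdist x z k)).
have [gb g1b] := gout (le_trans b (sqr_le_sqdist xr z k)).
by rewrite /Gam /G1 ga gb g1a g1b !mul0r addr0.
Qed.

(** Green's identity for the field with components [v * G1 k - Gam * v1 k]: its divergence is [v]
    times the sum of the [G2 k] minus [Gam] times the sum of the [v2 k], and its outward flux
    through every face is nonnegative. *)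
Lemma mv_kernel (v : 'rV[R]_n -> R) (v1 v2 : 'I_n -> 'rV[R]_n -> R) (eps : R) :
  let Q := box (n := n) mv_lo mv_up in
  0 < eps ->
  (forall k z, Q z -> pder k v z (v1 k z)) ->
  (forall k z, Q z -> pder k (v1 k) z (v2 k z)) ->
  (forall z, Q z -> {for z, continuous v}) ->
  (forall k z, Q z -> {for z, continuous (v2 k)}) ->
  (forall z, Q z -> 0 <= \sum_(k < n) v2 k z) ->
  (forall z, Q z -> z 0 i0 = 0 -> 0 <= v1 i0 z) ->
  \forall N \near \oo, 0 <= rsum N mv_lo (mesh mv_lo mv_up N) (fun z => v z *
    ((4 * sqdist x z * g2 (sqdist x z) + 2 * n%:R * g1 (sqdist x z)) +
     (4 * sqdist xr z * g2 (sqdist xr z) + 2 * n%:R * g1 (sqdist xr z))))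
    + eps * boxvol (n := n) mv_lo mv_up.
Proof.
have hl := l0; have hx := x0.
move=> Q e0 dv dv1 cv cv2 sv2 bv1.
have en : 0 < eps / n%:R by rewrite divr_gt0// ltr0n.
have div (k : 'I_n) : \forall N \near \oo,
    0 <= rsum N mv_lo (mesh mv_lo mv_up N) (fun z => v z * G2 k z - Gam z * v2 k z)
      + eps / n%:R * boxvol (n := n) mv_lo mv_up.
  apply: (rsum_div_ge mv_lo_up (k := k) (F := fun z => v z * G1 k z - Gam z * v1 k z)) => //.
  - move=> z Qz; have := pderB (pderM (dv k z Qz) (pder_G1 k z)) (pderM (pder_Gam k z) (dv1 k z Qz)).
    by move=> h; apply: (pder_eq h); ring.
  - move=> z Qz; apply: continuousB; apply: continuousM.
    + exact: cv.
    + exact: continuous_G2.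
    + exact: continuous_Gam.
    + exact: cv2.
  (* On an upper face both centres are at distance at least [l], so [Gam] and [G1] vanish. *)
  - move=> z Qz zk; have zk' : z 0 k = x 0 k + l by rewrite zk /mv_up coordE.
    have [||-> ->] := @vanish k z; last by rewrite mulr0 mul0r subrr.
      by rewrite zk' addrAC subrr add0r.
    rewrite mxE zk'; case: eqP => [->|_]; last by rewrite addrAC subrr add0r.
    by apply: lerXn2r; rewrite ?nnegrE; lra.
  - move=> z Qz zk.
    have [ki0|ki0] := eqVneq k i0; last first.
      have zk' : z 0 k = x 0 k - l.
        rewrite zk /mv_lo coordE ifF//; apply/negbTE.
        by apply: contraNneq ki0 => k0; apply/eqP/val_inj; rewrite /= k0 i0E.
      have [||-> ->] := @vanish k z; last by rewrite mulr0 mul0r subrr.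
        by rewrite zk' addrAC subrr add0r sqrrN.
      by rewrite mxE (negbTE ki0) zk' addrAC subrr add0r sqrrN.
    subst k; have : z 0 i0 = Num.max 0 (x 0 i0 - l).
      by rewrite zk /mv_lo coordE i0E.
    clear zk.
    (* If the cube does not cross the boundary hyperplane, then [x_0 >= l] and the mirror point is
       at distance [2 x_0 - l >= l] from this face. *)
    case: (leP 0 (x 0 i0 - l)) => xl zk.
      have [||-> ->] := @vanish i0 z; last by rewrite mulr0 mul0r subrr.
        by rewrite zk addrAC subrr add0r sqrrN.
      by rewrite mxE eqxx zk; apply: lerXn2r; rewrite ?nnegrE; lra.
    (* On the hyperplane [z_0 = 0] the two centres are equidistant and the normal derivatives of the
       two kernels cancel; only [- Gam * v1] is left, with the right sign. *)
    have sqE : sqdist xr z = sqdist x z.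
      apply: eq_bigr => j _; rewrite mxE; case: eqP => [->|//].
      by rewrite zk; ring.
    have -> : G1 i0 z = 0 by rewrite /G1 sqE mxE eqxx zk; ring.
    rewrite mulr0 sub0r oppr_le0 mulr_ge0 ?bv1//.
    by rewrite /Gam addr_ge0// g_ge0 ?sqdist_ge0.
near=> N; have N0 : (0 < N)%N by near: N; exact: nbhs_infty_gt.
have divN : forall k : 'I_n, 0 <= rsum N mv_lo (mesh mv_lo mv_up N) (fun z => v z * G2 k z - Gam z * v2 k z)
      + eps / n%:R * boxvol (n := n) mv_lo mv_up.
  near: N; exact: filter_forall.
have := @sumr_ge0 _ _ (index_enum 'I_n) predT _ (fun k _ => divN k).
rewrite big_split /= sumr_const card_ord -rsum_sum -mulrnAl.
have -> : eps / n%:R *+ n = eps.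
  by rewrite -mulr_natr divfK// pnatr_eq0 gtn_eqF.
(* The term [Gam] times the sum of the [v2 k] is nonnegative, so dropping it only increases the
   sum. *)
move=> /le_trans; apply; rewrite lerD2r; apply: rsum_le => [k|z].
  by apply: mesh_ge0; exact: mv_lo_up.
move=> /(gridbox_box _ _ _ N0) Qz.
rewrite -sum_G2 sumrB -!mulr_sumr gerBl.
by rewrite mulr_ge0 ?sv2// /Gam addr_ge0// g_ge0 ?sqdist_ge0.
Unshelve. all: by end_near. Qed.

End KernelSum.

End MeanValue.

(** The product of the kernel mass [(n/4) (2 rho)^-n] for [rho = sqrt n * d], the lower bound
    [(d/2)^n] for the volume of a cube of side [d], and the factor 1/2 from [v >= v x / 2]; the side
    [d] cancels. *)
Definition mv_const {R : realType} (n : nat) : R :=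
  n%:R / 4 / (2 * Num.sqrt n%:R) ^+ n / 2 ^+ n / 2.

Lemma mv_const_gt0 {R : realType} n : (0 < n)%N -> 0 < mv_const n :> R.
Proof.
move=> n0; have n0' : 0 < n%:R :> R by rewrite ltr0n.
by rewrite /mv_const !divr_gt0// exprn_gt0// mulr_gt0// sqrtr_gt0.
Qed.

(** * The mean value inequality, first for subharmonic functions *)

Section MeanValueCore.
Context {R : realType} {n : nat}.
Variables (i0 : 'I_n) (i0E : i0 = 0%N :> nat) (x : 'rV[R]_n) (l : R).
Hypotheses (l0 : 0 < l) (x0 : 0 <= x 0 i0).

Let Q := box (n := n) (mv_lo x l) (mv_up x l).
Let vol := boxvol (n := n) (mv_lo x l) (mv_up x l).
Let rs N := rsum (m := n) N (mv_lo x l) (mesh (mv_lo x l) (mv_up x l) N).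

Lemma mv_center : Q x.
Proof.
move=> k; rewrite (mv_lo_le i0E l0 x0) /mv_up coordE lerDl.
exact: ltW.
Qed.

(** In [mv_kernel] the factor of [v] is at most [2 P] everywhere, and at most [2 P - kap] on a small
    cube near [x] where [v >= v x / 2]. Thus [kap] times the mass of [v] on that cube is bounded by
    [2 P * M]. Bounds on Riemann sums of [v] take the place of its integral. *)
Lemma mv_core (v : 'rV[R]_n -> R) (v1 v2 : 'I_n -> 'rV[R]_n -> R) (M : R) :
  (forall k z, Q z -> pder k v z (v1 k z)) ->
  (forall k z, Q z -> pder k (v1 k) z (v2 k z)) ->
  (forall z, Q z -> {for z, continuous v}) ->
  (forall k z, Q z -> {for z, continuous (v2 k)}) ->
  (forall z, Q z -> 0 <= v z) ->
  (forall z, Q z -> 0 <= \sum_(k < n) v2 k z) ->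
  (forall z, Q z -> z 0 i0 = 0 -> 0 <= v1 i0 z) ->
  (forall eps : R, 0 < eps -> \forall N \near \oo, rs N v <= M + eps) ->
  v x * mv_const n <= 16 * n%:R / l ^+ n * M.
Proof.
move=> dv dv1 cv cv2 v0 sv2 bv1 Mv.
have hl := l0; have hx := x0.
have n0 : (0 < n)%N by apply: leq_ltn_trans (ltn_ord i0).
have n1 : 1 <= n%:R :> R by rewrite ler1n.
have lohi := mv_lo_up i0E l0 x0.
have [d1 d1_gt0 d1P] : exists2 d : R, 0 < d & forall z : 'rV[R]_n,
    (forall k, `|x 0 k - z 0 k| < d) -> Q z -> v x / 2 <= v z.
  have := v0 x mv_center; rewrite le_eqVlt => /orP[/eqP vx0|vx0].
    by exists 1 => // z _ Qz; rewrite -vx0 mul0r v0.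
  have vx2 : 0 < v x / 2 by rewrite divr_gt0.
  have [d d0 uc] := uniform_continuous_on (@compact_box R n _ _) cv vx2.
  exists d => // z xz _; have := uc x z mv_center xz.
  by rewrite ltr_norml => /andP[_]; lra.
(* The side [d] is such that [v >= v x / 2] on the cube, the cube lies in the ball of radius
   [rho = sqrt n * d], and [2 rho^2 <= l^2] as the kernel estimate demands. *)
have [d d0 [dd1 dl]] : exists2 d : R, 0 < d & d < d1 /\ 2 * (n%:R * d) <= l.
  exists (Num.min (d1 / 2) (l / (2 * n%:R))).
    by rewrite lt_min !divr_gt0// mulr_gt0//; lra.
  split; first by rewrite gt_min; apply/orP; left; lra.
  have : Num.min (d1 / 2) (l / (2 * n%:R)) <= l / (2 * n%:R) by rewrite ge_min lexx orbT.
  by rewrite ler_pdivlMr; lra.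
have d_nd : d <= n%:R * d by rewrite ler_peMl// ltW.
pose s : R := Num.sqrt n%:R.
have s2 : s ^+ 2 = n%:R by rewrite sqr_sqrtr//; lra.
have s0 : 0 < s by rewrite sqrtr_gt0; lra.
have sd0 : 0 < s * d by exact: mulr_gt0.
have sd2 : (s * d) ^+ 2 = n%:R * d ^+ 2 by rewrite exprMn s2.
have sdl : 2 * (s * d) ^+ 2 <= l ^+ 2.
  rewrite sd2; have : 2 * (n%:R * d) * d <= l * l.
    by apply: ler_pM => //; lra.
  by rewrite !expr2; lra.
have [g [g1 [g2 [dg dg1 cg2 gout [g_ge0 T_le T_le']]]]] := exists_kernel n0 l0 sd0.
set P := 8 * n%:R / l ^+ n in T_le T_le'.
set kap := n%:R / 4 / (2 * (s * d)) ^+ n in T_le'.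
have P0 : 0 <= P by rewrite divr_ge0 ?exprn_ge0//; lra.
have kap0 : 0 <= kap by rewrite !divr_ge0 ?exprn_ge0//; lra.
have vol0 : 0 <= vol by exact: (mv_vol_ge0 i0E l0 x0).
have vx0 := v0 x mv_center.
apply/ler_addgt0Pr => e e0.
pose eps := e / (2 * P + vol + 1).
have den0 : 0 < 2 * P + vol + 1 by lra.
have eps0 : 0 < eps by rewrite divr_gt0.
near \oo => N.
have ker : 0 <= rs N (fun z => v z *
    ((4 * sqdist x z * g2 (sqdist x z) + 2 * n%:R * g1 (sqdist x z)) +
     (4 * sqdist (mirror i0 x) z * g2 (sqdist (mirror i0 x) z) +
      2 * n%:R * g1 (sqdist (mirror i0 x) z)))) + eps * vol.
  by near: N; exact: (mv_kernel i0E l0 x0 dg dg1 cg2 gout g_ge0 eps0 dv dv1 cv cv2 sv2 bv1).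
have MN : rs N v <= M + eps by near: N; exact: Mv.
have [N0 hN] : (0 < N)%N /\ forall k : 'I_n, mesh (mv_lo x l) (mv_up x l) N k < d / 2.
  by near: N; apply: (mesh_lt lohi); rewrite divr_gt0.
have mesh0 k : 0 <= mesh (mv_lo x l) (mv_up x l) N k by exact: mesh_ge0.
(* The cube has [x] as its lower corner, so it stays in the half-space even when [x] is on the
   boundary. *)
pose u (k : nat) (t : R) : R := (coord x k <= t <= coord x k + d)%R%:R.
have u01 k (t : R) : 0 <= u k t <= 1 by rewrite /u ler0n lern1 leq_b1.
pose ind (z : 'rV[R]_n) := \prod_(k < n) u k (z 0 k).
have ind_ge : (d / 2) ^+ n <= rs N ind.
  rewrite /rs (rsum_prod n N _ _ u) -[in leLHS](card_ord n) -prodr_const.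
  apply: ler_prod => k _; rewrite divr_ge0 ?(ltW d0)//=.
  have hk := hN k.
  have lok : mv_lo x l k <= coord x k by rewrite coordE (mv_lo_le i0E l0 x0).
  have upk : coord x k + d <= mv_lo x l k + N%:R * mesh (mv_lo x l) (mv_up x l) N k.
    by rewrite (mesh_end _ _ _ N0) /mv_up lerD2l; lra.
  apply: (@le_trans _ _ (d - mesh (mv_lo x l) (mv_up x l) N k)); first by lra.
  have := grid_count_ge (mesh0 k) lok upk; apply.
have pt z : Q z -> v z *
    ((4 * sqdist x z * g2 (sqdist x z) + 2 * n%:R * g1 (sqdist x z)) +
     (4 * sqdist (mirror i0 x) z * g2 (sqdist (mirror i0 x) z) +
      2 * n%:R * g1 (sqdist (mirror i0 x) z))) <=
    (2 * P) * v z - (kap * (v x / 2)) * ind z.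
  move=> Qz; have vz := v0 z Qz.
  have T1 := T_le _ (sqdist_ge0 x z); have T2 := T_le _ (sqdist_ge0 (mirror i0 x) z).
  have ind1 : ind z <= 1 by rewrite prodr_ile1// => k _; exact: u01.
  have [/forallP inS|/forallPn[k outS]] := boolP [forall k : 'I_n, x 0 k <= z 0 k <= x 0 k + d].
    have qz : sqdist x z <= (s * d) ^+ 2.
      rewrite sd2 mulr_natl -[in leRHS](card_ord n) -sumr_const; apply: ler_sum => k _.
      have /andP[a b] := inS k; apply: lerXn2r; rewrite ?nnegrE; lra.
    have T3 := T_le' _ (sqdist_ge0 x z) qz sdl.
    have vxz : v x / 2 <= v z.
      apply: d1P => // k; have /andP[a b] := inS k.
      by rewrite distrC ger0_norm; lra.
    apply: (@le_trans _ _ (v z * (2 * P - kap))).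
      by apply: ler_wpM2l => //; lra.
    have : kap * (v x / 2) * ind z <= kap * v z * 1.
      apply: ler_pM => //.
      - by rewrite mulr_ge0//; lra.
      - by apply: prodr_ge0 => k _; have /andP[] := u01 k (z 0 k).
      - by rewrite ler_wpM2l.
    by lra.
  have -> : ind z = 0.
    by rewrite /ind (bigD1 k)//= /u coordE (negbTE outS) mul0r.
  rewrite mulr0 subr0 mulrC; apply: ler_wpM2r => //; lra.
have : 0 <= (2 * P) * rs N v - (kap * (v x / 2)) * rs N ind + eps * vol.
  apply: (le_trans ker); rewrite lerD2r -!rsumZ -rsumB.
  by apply: rsum_le => // z /(gridbox_box _ _ _ N0); exact: pt.
have : (kap * (v x / 2)) * (d / 2) ^+ n <= (kap * (v x / 2)) * rs N ind.
  by rewrite ler_wpM2l// mulr_ge0//; lra.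
have -> : (kap * (v x / 2)) * (d / 2) ^+ n = v x * mv_const n.
  rewrite /kap /mv_const -/s !exprMn exprVn.
  have : 2 ^+ n != 0 :> R by rewrite expf_neq0.
  have : s ^+ n != 0 :> R by rewrite expf_neq0// gt_eqF.
  have : d ^+ n != 0 :> R by rewrite expf_neq0// gt_eqF.
  by move: (2 ^+ n) (s ^+ n) (d ^+ n) => a b c ? ? ?; field; do ?[apply/andP; split].
have : (2 * P) * rs N v <= (2 * P) * (M + eps) by rewrite ler_wpM2l//; lra.
have -> : 16 * n%:R / l ^+ n = 2 * P by rewrite /P; field; rewrite expf_neq0// gt_eqF.
have : eps * (2 * P + vol + 1) = e by rewrite /eps divfK// gt_eqF.
by lra.
Unshelve. all: by end_near. Qed.

End MeanValueCore.

(** The quadratic correction uses a tangential coordinate [i1], hence leaves the normal derivative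
    alone; the linear one in [z_0] repairs the normal derivative and leaves the Laplacian alone. On
    [Q] both together are at most [A l^2 + 2 B l]. *)
Lemma mean_value_ineq {R : realType} {n : nat} (i0 i1 : 'I_n) (x : 'rV[R]_n) (l A B I : R)
    (e : 'rV[R]_n -> R) (e1 e2 : 'I_n -> 'rV[R]_n -> R) (g : 'rV[R]_n -> \bar R) :
  i0 = 0%N :> nat -> i1 != i0 -> 0 < l -> 0 <= x 0 i0 -> 0 <= A -> 0 <= B ->
  let Q := box (n := n) (mv_lo x l) (mv_up x l) in
  (forall k z, Q z -> pder k e z (e1 k z)) ->
  (forall k z, Q z -> pder k (e1 k) z (e2 k z)) ->
  (forall z, Q z -> {for z, continuous e}) ->
  (forall k z, Q z -> {for z, continuous (e2 k)}) ->
  (forall z, Q z -> 0 <= e z) ->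
  (forall z, Q z -> - \sum_(k < n) e2 k z <= A) ->
  (forall z, Q z -> z 0 i0 = 0 -> - e1 i0 z <= B) ->
  (forall z, (0 <= g z)%E) -> (forall z, Q z -> ((e z)%:E <= g z)%E) ->
  iint g = I%:E ->
  e x * mv_const n <= 16 * n%:R / l ^+ n * I + 16 * n%:R * 2 ^+ n * (A * l ^+ 2 + 2 * B * l).
Proof.
move=> i0E i10 l0 x0 A0 B0 Q de de1 ce ce2 e0 lapA nB g0 eg gI.
pose c := x 0 i1; pose a := mv_lo x l 0%N.
pose q (z : 'rV[R]_n) := z 0 i1 - c.
pose v z := e z + A / 2 * (q z * q z) + B * (z 0 i0 - a).
pose v1 k z := e1 k z + (i1 == k)%:R * (A * q z) + (i0 == k)%:R * B.
pose v2 k z := e2 k z + A * (i1 == k)%:R.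
pose vol := boxvol (n := n) (mv_lo x l) (mv_up x l).
have dq k z : pder k q z (i1 == k)%:R.
  by have := pderB (pder_coord k i1 z) (pder_cst k c z); rewrite subr0.
have cq z : {for z, continuous q}.
  by apply: continuousB; [exact: coord_continuous|exact: cst_continuous].
have ale z : Q z -> a <= z 0 i0 <= a + 2 * l.
  move=> /(_ i0); have := mv_width x l0 0%N; rewrite i0E -/a.
  by move=> ? /andP[? ?]; apply/andP; split; lra.
have qle z : Q z -> q z * q z <= l ^+ 2.
  move=> /(_ i1); rewrite /mv_lo /mv_up coordE -/c.
  rewrite ifF; last by apply/negbTE; apply: contraNneq i10 => i1E; apply/eqP/val_inj; rewrite /= i0E.
  by move=> /andP[? ?]; rewrite -subr_ge0 /q; nra.
have n0 : (0 < n)%N by apply: leq_ltn_trans (ltn_ord i0).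
have vol0 : 0 <= vol by exact: (mv_vol_ge0 i0E l0 x0).
have vol_le : vol <= (2 * l) ^+ n by exact: (mv_vol_le i0E l0 x0).
have lohi := mv_lo_up i0E l0 x0.
pose D := A * l ^+ 2 + 2 * B * l.
have D0 : 0 <= D by rewrite addr_ge0// !mulr_ge0 ?exprn_ge0// ltW.
have core : v x * mv_const n <= 16 * n%:R / l ^+ n * (I + D * vol).
  apply: (@mv_core R n i0 i0E x l l0 x0 v v1 v2).
  - move=> k z Qz.
    have d1 := pderM (pder_cst k (A / 2) z) (pderM (dq k z) (dq k z)).
    have d2 := pderM (pder_cst k B z) (pderB (pder_coord k i0 z) (pder_cst k a z)).
    apply: (pder_eq (pderD (pderD (de k z Qz) d1) d2)); rewrite /v1.
    by move: (i1 == k)%:R (i0 == k)%:R => s t; field.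
  - move=> k z Qz.
    have d1 := pderM (pder_cst k (i1 == k)%:R z) (pderM (pder_cst k A z) (dq k z)).
    apply: (pder_eq (pderD (pderD (de1 k z Qz) d1) (pder_cst k ((i0 == k)%:R * B) z))).
    by rewrite /v2; case: (i1 == k) => /=; ring.
  - move=> z Qz; apply: continuousD; first apply: continuousD.
    + exact: ce.
    + apply: continuousM; first exact: cst_continuous.
      by apply: continuousM; exact: cq.
    + apply: continuousM; first exact: cst_continuous.
      by apply: continuousB; [exact: coord_continuous|exact: cst_continuous].
  - move=> k z Qz; apply: continuousD; first exact: ce2.
    exact: cst_continuous.
  - move=> z Qz; have /andP[az _] := ale z Qz.
    rewrite /v !addr_ge0 ?e0//; first by rewrite mulr_ge0 -?expr2 ?sqr_ge0// divr_ge0.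
    by rewrite mulr_ge0// subr_ge0.
  - move=> z Qz; rewrite /v2 big_split /= -mulr_sumr.
    have : 0 <= A * \sum_(k < n) (i1 == k)%:R by rewrite mulr_ge0// sumr_ge0.
    have : 1 <= \sum_(k < n) (i1 == k)%:R :> R.
      by rewrite (bigD1 i1)// eqxx lerDl sumr_ge0.
    by move: (\sum_(k < n) (i1 == k)%:R) => S S1 _; have := lapA z Qz; nra.
  - move=> z Qz z0; rewrite /v1 eqxx (negbTE i10) mul0r mul1r addr0.
    by have := nB z Qz z0; lra.
  move=> eps eps0.
  have ev0 : 0 < eps / (vol + 1) by rewrite divr_gt0//; lra.
  near=> N; have N0 : (0 < N)%N by near: N; exact: nbhs_infty_gt.
  have : ((rsum N (mv_lo x l) (mesh (mv_lo x l) (mv_up x l) N) e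
      - eps / (vol + 1) * vol)%:E <= iint g)%E.
    by near: N; exact: (rsum_le_iint_mesh lohi ev0 ce g0 eg).
  rewrite gI lee_fin => eI.
  have : eps / (vol + 1) * vol <= eps.
    by rewrite mulrAC ler_pdivrMr; [rewrite ler_pM2l//|]; lra.
  have : rsum N (mv_lo x l) (mesh (mv_lo x l) (mv_up x l) N) v <=
      rsum N (mv_lo x l) (mesh (mv_lo x l) (mv_up x l) N) (fun z => e z + D).
    apply: rsum_le => [k|z /(gridbox_box _ _ _ N0) Qz]; first exact: mesh_ge0.
    have /andP[_ za] := ale z Qz; have qz := qle z Qz.
    have : A * (q z * q z) <= A * l ^+ 2 by rewrite ler_wpM2l.
    have : B * (z 0 i0 - a) <= B * (2 * l) by rewrite ler_wpM2l//; lra.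
    have : 0 <= A * (q z * q z) by rewrite mulr_ge0 -?expr2 ?sqr_ge0.
    by rewrite /v /D; lra.
  by rewrite rsumD (rsum_mesh_cst _ _ _ N0) -/vol; lra.
(* At the centre the quadratic correction vanishes and the linear one is nonnegative. *)
have ex : e x <= v x.
  rewrite /v /q subrr mulr0 mulr0 addr0 lerDl mulr_ge0// subr_ge0.
  by have := mv_lo_le i0E l0 x0 i0; rewrite i0E.
have c0 : 0 <= mv_const n :> R by rewrite ltW ?mv_const_gt0.
apply: (le_trans (ler_wpM2r c0 ex)); apply: (le_trans core).
rewrite mulrDr lerD2l -/D.
have -> : 16 * n%:R * 2 ^+ n * D = 16 * n%:R / l ^+ n * (D * (2 * l) ^+ n).
  by rewrite exprMn; field; rewrite expf_neq0// gt_eqF.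
by rewrite ler_wpM2l ?ler_wpM2l// divr_ge0 ?exprn_ge0 ?mulr_ge0// ltW.
Unshelve. all: by end_near. Qed.

(** * Arithmetic of the absorption *)

Section HeinzArithmetic.
Context {R : realType}.

Lemma exprD_le (n : nat) (x y : R) : 0 <= x -> 0 <= y ->
  (x + y) ^+ n <= 2 ^+ n * (x ^+ n + y ^+ n).
Proof.
wlog xy : x y / x <= y => [W x0 y0|x0 y0].
  have [xy|/ltW yx] := leP x y; first exact: W.
  by rewrite [x + y]addrC [x ^+ n + _]addrC; exact: W.
apply: (@le_trans _ _ ((2 * y) ^+ n)); first by apply: lerXn2r; rewrite ?nnegrE; lra.
by rewrite exprMn ler_wpM2l ?exprn_ge0// lerDr exprn_ge0.
Qed.

Lemma exprD4_le (n : nat) (x y z w : R) : 0 <= x -> 0 <= y -> 0 <= z -> 0 <= w ->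
  (x + y + z + w) ^+ n <= 4 ^+ n * (x ^+ n + y ^+ n + z ^+ n + w ^+ n).
Proof.
move=> x0 y0 z0 w0.
have h1 : (x + y + z + w) ^+ n <= 2 ^+ n * ((x + y) ^+ n + (z + w) ^+ n).
  by rewrite -addrA; apply: exprD_le; exact: addr_ge0.
have h2 := exprD_le n x0 y0; have h3 := exprD_le n z0 w0.
apply: (le_trans h1).
have -> : 4 ^+ n = 2 ^+ n * 2 ^+ n :> R by rewrite -exprMn; congr (_ ^+ n); ring.
by rewrite -mulrA ler_wpM2l ?exprn_ge0//; lra.
Qed.

(** With [y] an [n]-th root, the fractional powers in the hypotheses become natural ones. *)
Lemma powR_root (n k : nat) (y : R) : (0 < n)%N -> 0 <= y ->
  powR (y ^+ n) (k%:R / n%:R) = y ^+ k.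
Proof.
move=> n0 y0; rewrite -powR_mulrn// -powRrM mulrC divfK ?powR_mulrn//.
by rewrite pnatr_eq0 gtn_eqF.
Qed.

(** The square bound serves the Laplacian terms, which carry [l^2], and the linear one the boundary
    terms, which carry [l]. *)
Lemma small_scale (u L G : R) : 0 <= u -> u * L <= 1 -> 1 <= L -> G <= L ->
  u * G <= 1 /\ u ^+ 2 * G <= 1.
Proof.
move=> u0 uL L1 GL; have uG : u * G <= u * L by rewrite ler_wpM2l.
have uu : u * 1 <= u * L by rewrite ler_wpM2l.
by split; [lra|rewrite expr2 -mulrA; nra].
Qed.

(* The scale [l] is so small that the nonlinear terms are absorbed in the
   left-hand side; the part [(M m)^n I] of [I / l^n] is absorbed because [I] is small. *)
Lemma heinz_absorb (n : nat) (K a b A0 al B0 B1 m tau I : R) :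
  let Lam := 1 + 8 * K * 2 ^+ n in
  let M := 1 + 8 * K * 2 ^+ n.+2 * (a + b) in
  let l := (2 / tau + Lam * al + Lam * B1 + M * m)^-1 in
  0 < K -> 0 <= a -> 0 <= b -> 0 <= al -> 0 <= B1 ->
  0 <= m -> 0 < tau -> 0 <= I -> I * (4 * K * 4 ^+ n * M ^+ n) <= 1 ->
  m ^+ n <= K * ((A0 + al ^+ 2 * (2 * m) ^+ n + a * (2 * m) ^+ n.+2) * l ^+ 2 +
                 (B0 + B1 * (2 * m) ^+ n + b * (2 * m) ^+ n.+1) * l + I / l ^+ n) ->
  m ^+ n <= 4 * K * (A0 * l ^+ 2 + B0 * l) +
    4 * K * 4 ^+ n * ((2 / tau) ^+ n + Lam ^+ n * (al ^+ n + B1 ^+ n)) * I.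
Proof.
move=> Lam M l K0 a0 b0 al0 B10 m0 tau0 I0 Imu.
have p2 k : 1 <= 2 ^+ k :> R by rewrite exprn_ege1 ?ler1n.
have K2 k : 0 <= 8 * K * 2 ^+ k by rewrite !mulr_ge0 ?exprn_ge0// ltW.
have Lam1 : 1 <= Lam by rewrite lerDl.
have M1 : 1 <= M by rewrite lerDl mulr_ge0// addr_ge0.
have t0 : 0 < 2 / tau by rewrite divr_gt0.
have La0 : 0 <= Lam * al by rewrite mulr_ge0//; lra.
have LB0 : 0 <= Lam * B1 by rewrite mulr_ge0//; lra.
have Mm0 : 0 <= M * m by rewrite mulr_ge0//; lra.
have s0 : 0 < 2 / tau + Lam * al + Lam * B1 + M * m by lra.
have l0 : 0 < l by rewrite invr_gt0.
have ls : l * (2 / tau + Lam * al + Lam * B1 + M * m) = 1 by rewrite mulVf// gt_eqF.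
have sub_ls u : 0 <= u -> u <= 2 / tau + Lam * al + Lam * B1 + M * m -> l * u <= 1.
  by move=> u0 us; rewrite -ls ler_wpM2l// ltW.
have l0' := ltW l0.
have mn0 : 0 <= m ^+ n by rewrite exprn_ge0.
have [_ h1] : l * al * (8 * K * 2 ^+ n) <= 1 /\ (l * al) ^+ 2 * (8 * K * 2 ^+ n) <= 1.
  apply: (@small_scale _ Lam) => //; first exact: mulr_ge0.
    by rewrite -mulrA [al * _]mulrC; apply: sub_ls => //; lra.
  by rewrite lerDr.
have [h2 _] : l * B1 * (8 * K * 2 ^+ n) <= 1 /\ (l * B1) ^+ 2 * (8 * K * 2 ^+ n) <= 1.
  apply: (@small_scale _ Lam) => //; first exact: mulr_ge0.
    by rewrite -mulrA [B1 * _]mulrC; apply: sub_ls => //; lra.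
  by rewrite lerDr.
have lmM : l * m * M <= 1.
  by rewrite -mulrA [m * _]mulrC; apply: sub_ls => //; lra.
have lm0 : 0 <= l * m by exact: mulr_ge0.
have aM : 8 * K * 2 ^+ n.+2 * a <= M.
  by rewrite /M; have := mulr_ge0 (K2 n.+2) b0; lra.
have bM : 8 * K * 2 ^+ n.+1 * b <= M.
  rewrite /M; have := mulr_ge0 (K2 n.+2) a0; have := mulr_ge0 (K2 n.+1) b0.
  have -> : 8 * K * 2 ^+ n.+2 = 2 * (8 * K * 2 ^+ n.+1) by rewrite [2 ^+ n.+2]exprS; ring.
  by lra.
have [_ h3] := small_scale lm0 lmM M1 aM.
have [h4 _] := small_scale lm0 lmM M1 bM.
have h5 : I / l ^+ n <= 4 ^+ n * ((2 / tau) ^+ n + (Lam * al) ^+ n + (Lam * B1) ^+ n + (M * m) ^+ n) * I.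
  rewrite mulrC ler_wpM2r// -exprVn invrK.
  by apply: exprD4_le => //; exact: ltW.
have {}h5 := ler_wpM2l (ltW K0) h5.
(* Each of the four terms with [al], [B1], [a], [b] is at most [m^n / 8], and the part of [I / l^n]
   with [(M m)^n] at most [m^n / 4]. Together they take [3/4] of the left-hand side, whence the
   factor 4 in the conclusion. *)
have g1 := ler_wpM2l mn0 h1; have g2 := ler_wpM2l mn0 h2.
have g3 := ler_wpM2l mn0 h3; have g4 := ler_wpM2l mn0 h4.
have g5 := ler_wpM2l mn0 Imu.
move=> H.
rewrite !exprMn !(exprS _ n.+1) !(exprS _ n) in H g1 g2 g3 g4 g5 h5 *.
by lra.
Qed.

End HeinzArithmetic.

(** * Sup-norm balls and the choice of the maximum point *)

Section SupBoxes.
Context {R : realType} {n : nat}.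
Variables (i0 : 'I_n) (i0E : i0 = 0%N :> nat).
Implicit Types x y z : 'rV[R]_n.

Lemma normr_rV_le z (t : R) : 0 <= t -> (`|z| <= t) = [forall k : 'I_n, `|z 0 k| <= t].
Proof.
move=> t0; rewrite [`|z|]mx_normrE; apply/bigmax_leP/forallP => [[_ h] k|h].
  exact: (h (0, k)).
by split=> // -[i k] _ /=; rewrite ord1; exact: h.
Qed.

Lemma mv_boxP x z (l : R) : 0 <= l ->
  box (n := n) (mv_lo x l) (mv_up x l) z <-> `|z - x| <= l /\ 0 <= z 0 i0.
Proof.
move=> l0; rewrite normr_rV_le//; split=> [bz|[/forallP zx z0] k].
  split.
    apply/forallP => k; have := bz k; rewrite /mv_lo /mv_up coordE !mxE ler_norml.
    case: ifP => _ /andP[a b]; apply/andP; split; try lra.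
    have : x 0 k - l <= Num.max 0 (x 0 k - l) by rewrite le_max lexx orbT.
    by lra.
  have := bz i0; rewrite /mv_lo coordE i0E eqxx => /andP[a _].
  by apply: le_trans a; rewrite le_max lexx.
have := zx k; rewrite !mxE ler_norml /mv_lo /mv_up coordE => /andP[a b].
case: eqP => [k0|_]; last by apply/andP; split; lra.
have ki : k = i0 by apply/val_inj; rewrite /= k0 i0E.
by move: a b; rewrite ki ge_max z0 => a b; apply/andP; split; lra.
Qed.

(** The squared Euclidean distance is at most [n (r/n)^2 = r^2 / n], which is below [r^2] for
    [n > 1]. *)
Lemma eball_sup x y (r : R) : (1 < n)%N -> 0 < r -> `|x - y| <= r / n%:R -> eball y r x.
Proof.
move=> n1 r0; have n0 : 1 < n%:R :> R by rewrite ltr1n.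
rewrite normr_rV_le; last by rewrite divr_ge0// ltW.
move=> /forallP xy; rewrite /eball/=.
apply: (@le_lt_trans _ _ (\sum_(k < n) (r / n%:R) ^+ 2)).
  apply: ler_sum => k _; have := xy k; rewrite !mxE => h.
  by rewrite -real_normK ?num_real//; apply: lerXn2r; rewrite ?nnegrE// divr_ge0// ltW//; lra.
rewrite sumr_const card_ord.
have -> : (r / n%:R) ^+ 2 *+ n = r ^+ 2 / n%:R by rewrite -[LHS]mulr_natr; field; lra.
by rewrite ltr_pdivrMr ?ltr_pMr ?exprn_gt0//; lra.
Qed.

End SupBoxes.

(* Maximizing [(R0 - |x - y|)^n e x] over the sup-norm ball of radius [R0]. *)
Lemma heinz_point {R : realType} {n : nat} (i0 : 'I_n) (y : 'rV[R]_n) (R0 : R) (e : 'rV[R]_n -> R) :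
  i0 = 0%N :> nat -> 0 < R0 -> 0 <= y 0 i0 ->
  (forall x : 'rV[R]_n, `|x - y| <= R0 -> 0 <= x 0 i0 -> {for x, continuous e} /\ 0 <= e x) ->
  0 < e y ->
  exists x, let tau := R0 - `|x - y| in
   [/\ 0 <= x 0 i0, 0 < tau, 0 < e x, R0 ^+ n * e y <= tau ^+ n * e x &
     forall z, `|z - x| <= tau / 2 -> 0 <= z 0 i0 -> e z <= 2 ^+ n * e x].
Proof.
move=> i0E R00 y0 he ey.
have R0ge := ltW R00.
have boxE := fun z => mv_boxP i0E y z R0ge.
pose f (x : 'rV[R]_n) := (R0 - `|x - y|) ^+ n * e x.
have [||xb] := @compact_EVT_max _ R f (box (n := n) (mv_lo y R0) (mv_up y R0)) _ (@compact_box R n _ _).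
- by exists y; apply/boxE; rewrite subrr normr0.
- apply: continuous_in_subspaceT => x /set_mem/boxE[xy x0].
  have cn : {for x, continuous (fun x : 'rV[R]_n => `|x - y|)}.
    apply: (@continuous_comp _ _ _ (fun x : 'rV[R]_n => x - y) (fun z : 'rV[R]_n => `|z|)); last exact: norm_continuous.
    by apply: continuousB; [exact: cvg_id|exact: cst_continuous].
  have cd : {for x, continuous (fun x : 'rV[R]_n => R0 - `|x - y|)}.
    by apply: continuousB; [exact: cst_continuous|exact: cn].
  exact: (continuousM (continuous_exprn (n := n) cd) (he x xy x0).1).
move=> /set_mem/boxE[xy xb0] xmax.
have fmax z : `|z - y| <= R0 -> 0 <= z 0 i0 -> f z <= f xb.
  by move=> zy z0; apply: xmax; apply/mem_set/boxE.
have n0 : (0 < n)%N by apply: leq_ltn_trans (ltn_ord i0).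
exists xb => tau.
have fy : R0 ^+ n * e y <= tau ^+ n * e xb.
  by have := fmax y; rewrite /f subrr normr0 subr0; apply.
have pos : 0 < tau ^+ n * e xb by apply: lt_le_trans fy; rewrite mulr_gt0 ?exprn_gt0.
have tau0 : 0 <= tau by rewrite subr_ge0.
have tau_gt0 : 0 < tau.
  rewrite lt_neqAle tau0 andbT; apply: contraTneq pos => <-.
  by rewrite expr0n gtn_eqF// mul0r ltxx.
have exb : 0 < e xb by move: pos; rewrite pmulr_rgt0 ?exprn_gt0.
split=> // z zx z0.
(* Such a [z] still has distance [tau / 2] to spare, so maximality gives
   [(tau/2)^n e z <= tau^n e xb]. *)
have zy : `|z - y| <= R0 - tau / 2.
  rewrite -(subrK xb z) -addrA; apply: (le_trans (ler_normD _ _)).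
  by rewrite /tau in zx *; lra.
have ez : 0 <= e z by have [|_] := he z _ z0; first lra.
have : f z <= tau ^+ n * e xb by apply: fmax => //; lra.
have : (tau / 2) ^+ n * e z <= f z.
  by rewrite /f ler_wpM2r//; apply: lerXn2r; rewrite ?nnegrE; lra.
move=> a b; have := le_trans a b.
rewrite expr_div_n mulrAC ler_pdivrMr ?exprn_gt0// -mulrA ler_pM2l ?exprn_gt0//.
by rewrite mulrC.
Qed.

(** Carries the estimate from the maximum point back to [y] by multiplying it by
    [th = (tau / (r/n))^n <= 1], which converts [(2/tau)^n] into [(2n)^n r^-n]. *)
Lemma heinz_conclude {R : realType} (n : nat) (K Lam A0 B0 X r tau l I c ey C : R) :
  C = 4 * K * 4 ^+ n * (1 + (2 * n%:R) ^+ n + Lam ^+ n) ->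
  (0 < n)%N -> 0 < K -> 0 <= Lam -> 0 <= A0 -> 0 <= B0 -> 0 <= X -> 0 <= I ->
  0 < r -> 0 < tau -> tau <= r / n%:R -> 0 < l -> l <= tau / 2 ->
  (r / n%:R) ^+ n * ey <= tau ^+ n * c ->
  c <= 4 * K * (A0 * l ^+ 2 + B0 * l) +
    4 * K * 4 ^+ n * ((2 / tau) ^+ n + Lam ^+ n * X) * I ->
  ey <= C * A0 * r ^+ 2 + C * B0 * r + C * (X + r ^- n) * I.
Proof.
move=> CE n0 K0 L0 A00 B00 X0 I0 r0 tau0 taur l0 ltau Hy Hc.
have n1 : 1 <= n%:R :> R by rewrite ler1n.
have nN0 : n%:R != 0 :> R by rewrite gt_eqF//; lra.
have rn0 : 0 < r / n%:R by rewrite divr_gt0//; lra.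
have rnr : r / n%:R <= r by rewrite ler_pdivrMr ?ler_peMr//; lra.
have lr : l <= r by lra.
pose th := (tau / (r / n%:R)) ^+ n.
have th0 : 0 <= th by rewrite exprn_ge0// divr_ge0// ltW.
have th1 : th <= 1.
  apply: exprn_ile1; first by rewrite divr_ge0// ltW.
  by rewrite ler_pdivrMr// mul1r.
have ey_le : ey <= th * c.
  rewrite /th expr_div_n mulrAC ler_pdivlMr ?exprn_gt0//.
  by rewrite mulrC.
have tht : th * (2 / tau) ^+ n = (2 * n%:R) ^+ n * r ^- n.
  rewrite /th -exprMn -exprVn -exprMn; congr (_ ^+ n); field.
  by rewrite nN0 !gt_eqF.
have q4 : 1 <= 4 ^+ n :> R by rewrite exprn_ege1// ler1n.
have Ln : 0 <= Lam ^+ n by rewrite exprn_ge0.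
have nn : 0 <= (2 * n%:R) ^+ n :> R by rewrite exprn_ge0//; lra.
have rV : 0 <= r ^- n by rewrite invr_ge0 exprn_ge0// ltW.
pose E := 4 * K * 4 ^+ n.
have KE : 4 * K <= E by rewrite /E ler_peMr//; lra.
have EC : E <= C by rewrite CE -/E ler_peMr//; lra.
have E0 : 0 <= E by lra.
have Al : A0 * l ^+ 2 <= A0 * r ^+ 2.
  by rewrite ler_wpM2l//; apply: lerXn2r; rewrite ?nnegrE; lra.
have Bl : B0 * l <= B0 * r by rewrite ler_wpM2l.
have P0 : 0 <= A0 * l ^+ 2 + B0 * l.
  by rewrite addr_ge0 ?mulr_ge0 ?sqr_ge0// ltW.
have s1 : th * (4 * K * (A0 * l ^+ 2 + B0 * l)) <= C * (A0 * r ^+ 2 + B0 * r).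
  apply: (@le_trans _ _ (1 * (4 * K * (A0 * l ^+ 2 + B0 * l)))).
    by rewrite ler_wpM2r// mulr_ge0//; lra.
  by rewrite mul1r; apply: ler_pM => //; lra.
have s2 : th * (E * ((2 / tau) ^+ n + Lam ^+ n * X) * I) <= C * (X + r ^- n) * I.
  rewrite mulrA ler_wpM2r//.
  have -> : th * (E * ((2 / tau) ^+ n + Lam ^+ n * X)) =
      E * ((2 * n%:R) ^+ n * r ^- n + th * (Lam ^+ n * X)) by rewrite -tht; ring.
  have LX : 0 <= Lam ^+ n * X by rewrite mulr_ge0.
  have : th * (Lam ^+ n * X) <= Lam ^+ n * X by rewrite ler_piMl.
  have : (2 * n%:R) ^+ n * r ^- n + Lam ^+ n * X <=
      (1 + (2 * n%:R) ^+ n + Lam ^+ n) * (X + r ^- n).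
    have := mulr_ge0 nn X0; have := mulr_ge0 Ln rV; lra.
  move=> a b; rewrite CE -/E -mulrA ler_wpM2l//; lra.
apply: (le_trans ey_le); apply: (le_trans (ler_wpM2l th0 Hc)).
by rewrite mulrDr -/E; lra.
Qed.

(** * Assembling the estimate *)

Theorem theorem2p4 (R : realType) (n : nat) (hn : (2 <= n)%N) :
  let i0 : 'I_n := Ordinal (ltnW hn) in
  let H : set 'rV[R]_n := [set x | 0 <= x 0 i0] in
  let dH : set 'rV[R]_n := [set x | x 0 i0 = 0] in
  exists C : R, forall a b : R, 0 <= a -> 0 <= b ->
  exists mu : R, 0 < mu /\
  forall (y : 'rV[R]_n) (r : R) (e : 'rV[R]_n -> R) (A0 A1 B0 B1 : R),
    H y -> 0 < r ->
    let D := eball y r `&` H in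
    C2_on D e ->
    (forall x, D x -> 0 <= e x) ->
    0 <= A0 -> 0 <= A1 -> 0 <= B0 -> 0 <= B1 ->
    (forall x, D x ->
       laplacian e x <= A0 + A1 * e x + a * powR (e x) ((n + 2)%:R / n%:R)) ->
    (forall x, D x -> dH x ->
       - partial i0 e x <= B0 + B1 * e x + b * powR (e x) ((n + 1)%:R / n%:R)) ->
    (int_over D e <= mu%:E)%E ->
    ((e y)%:E <= (C * A0 * r ^+ 2 + C * B0 * r)%:E
       + (C * (powR A1 (n%:R / 2) + B1 ^+ n + r ^- n))%:E * int_over D e)%E.
Proof.
move=> i0 H dH.
have i0E : i0 = 0%N :> nat by [].
pose i1 : 'I_n := Ordinal hn; have i10 : i1 != i0 by [].
have n0 : (0 < n)%N by exact: ltnW.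
have n1 : 1 <= n%:R :> R by rewrite ler1n.
have c0 := @mv_const_gt0 R n n0.
(* The larger of the two coefficients in [mean_value_ineq], divided by [mv_const n]. *)
pose K : R := 16 * n%:R * 2 ^+ n * 2 / mv_const n.
have p2 : 1 <= 2 ^+ n :> R by rewrite exprn_ege1// ler1n.
have K0 : 0 < K by rewrite /K divr_gt0// !mulr_gt0 ?exprn_gt0//; lra.
have KE : K * mv_const n = 16 * n%:R * 2 ^+ n * 2 by rewrite /K divfK// gt_eqF.
clearbody K.
pose Lam := 1 + 8 * K * 2 ^+ n.
exists (4 * K * 4 ^+ n * (1 + (2 * n%:R) ^+ n + Lam ^+ n)) => a b a0 b0.
pose M := 1 + 8 * K * 2 ^+ n.+2 * (a + b).
have K8 k : 0 <= 8 * K * 2 ^+ k by rewrite !mulr_ge0 ?exprn_ge0 ?(ltW K0).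
have Lam0 : 0 <= Lam by rewrite addr_ge0.
have M0 : 0 < M by rewrite ltr_pwDl// mulr_ge0 ?addr_ge0.
have den0 : 0 < 4 * K * 4 ^+ n * M ^+ n by rewrite !mulr_gt0// exprn_gt0.
(* This [mu] is exactly the smallness of the integral required by [heinz_absorb]; only here do [a]
   and [b] enter, through [M]. *)
exists (4 * K * 4 ^+ n * M ^+ n)^-1; split; first by rewrite invr_gt0.
move=> y r e A0 A1 B0 B1 yH r0 D [U [_ DU dU dpU cpU]] epos A00 A10 B00 B10 lap nrm.
pose g := fun x : 'rV[R]_n => ((x \in D)%:R * e x)%:E.
have g0 z : (0 <= g z)%E.
  rewrite lee_fin; case: (boolP (z \in D)) => [/set_mem Dz|_]; last by rewrite mul0r.
  by rewrite mul1r; exact: epos.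
have gD z : D z -> g z = (e z)%:E by move=> Dz; rewrite /g mem_set// mul1r.
have gI0 : (0 <= iint g)%E by exact: iint_ge0.
rewrite /int_over -/g => gmu.
have [I gI] : exists I : R, iint g = I%:E.
  by move: gmu gI0; case: (iint g) => // I _ _; exists I.
move: gmu gI0; rewrite gI !lee_fin => gmu I0.
have Imu : I * (4 * K * 4 ^+ n * M ^+ n) <= 1 by rewrite -ler_pdivlMr// mul1r.
pose al := Num.sqrt A1.
have al0 : 0 <= al by exact: sqrtr_ge0.
have al2 : al ^+ 2 = A1 by rewrite sqr_sqrtr.
have -> : powR A1 (n%:R / 2) = al ^+ n by rewrite -al2 powR_root.
have C0 : 0 <= 4 * K * 4 ^+ n * (1 + (2 * n%:R) ^+ n + Lam ^+ n).
  by rewrite !mulr_ge0 ?addr_ge0 ?exprn_ge0 ?mulr_ge0// ltW.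
have X0 : 0 <= al ^+ n + B1 ^+ n by rewrite addr_ge0 ?exprn_ge0.
(* [heinz_point] needs [e y > 0]; otherwise the claim holds because the right-hand side is
   nonnegative. *)
have [ey|ey] := leP (e y) 0.
  have rV : 0 <= r ^- n by rewrite invr_ge0 exprn_ge0// ltW.
  have r0' := ltW r0; apply: (le_trans ey); rewrite addr_ge0// ?addr_ge0//.
  - by rewrite mulr_ge0 ?exprn_ge0 // mulr_ge0.
  - by rewrite mulr_ge0// mulr_ge0.
  - by rewrite mulr_ge0// mulr_ge0// addr_ge0.
have rn0 : 0 < r / n%:R by rewrite divr_gt0//; lra.
have supD x : `|x - y| <= r / n%:R -> 0 <= x 0 i0 -> D x.
  by move=> xy x0; split => //; exact: eball_sup.
have ce x : D x -> {for x, continuous e}.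
  by move=> Dx; exact/differentiable_continuous/dU/DU.
have he x : `|x - y| <= r / n%:R -> 0 <= x 0 i0 -> {for x, continuous e} /\ 0 <= e x.
  by move=> xy x0; split; [apply: ce|apply: epos]; exact: supD.
have [x [x0 tau0 ex emax enear]] := heinz_point i0E rn0 yH he ey.
set tau := r / n%:R - `|x - y| in tau0 emax enear.
pose m := powR (e x) n%:R^-1.
have m0 : 0 <= m by exact: powR_ge0.
have mn : m ^+ n = e x.
  rewrite -powR_mulrn// /m -powRrM mulVf ?powRr1 ?(ltW ex)//.
  by rewrite gt_eqF//; lra.
(* The scale of the mean value inequality is [l = s^-1]; the summand [2 / tau] forces
   [l <= tau / 2], so that the cube stays where [e <= (2 m)^n]. *)
pose s := 2 / tau + Lam * al + Lam * B1 + M * m.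
have st : 2 / tau <= s.
  by rewrite /s -!addrA lerDl !addr_ge0// mulr_ge0// ltW.
have t20 : 0 < 2 / tau by rewrite divr_gt0.
have s0 : 0 < s by lra.
have l0 : 0 < s^-1 by rewrite invr_gt0.
have ltau : s^-1 <= tau / 2.
  by rewrite -[tau / 2]invf_div lef_pV2 ?posrE.
have Qnear z : box (n := n) (mv_lo x s^-1) (mv_up x s^-1) z -> [/\ D z & e z <= (2 * m) ^+ n].
  move=> /(mv_boxP i0E _ _ (ltW l0))[zx z0]; split.
    apply: supD => //; rewrite -(subrK x z) -addrA; apply: (le_trans (ler_normD _ _)).
    by rewrite /tau in tau0 ltau; lra.
  by rewrite exprMn mn; apply: enear => //; exact: le_trans ltau.
(* On the cube the nonlinear terms are thus bounded by the constants [a (2 m)^(n+2)] and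
   [b (2 m)^(n+1)]. *)
have powle k z : D z -> e z <= (2 * m) ^+ n -> powR (e z) (k%:R / n%:R) <= (2 * m) ^+ k.
  move=> Dz ez; rewrite -(@powR_root _ n k (2 * m))// ?mulr_ge0//.
  apply: ge0_ler_powR => //; rewrite ?nnegrE ?divr_ge0 ?exprn_ge0 ?mulr_ge0//.
  exact: epos.
have MV := @mean_value_ineq R n i0 i1 x s^-1
  (A0 + al ^+ 2 * (2 * m) ^+ n + a * (2 * m) ^+ n.+2)
  (B0 + B1 * (2 * m) ^+ n + b * (2 * m) ^+ n.+1) I e (fun k => partial k e)
  (fun k => partial k (partial k e)) g i0E i10 l0 x0.
have m20 k : 0 <= (2 * m) ^+ k by rewrite exprn_ge0// mulr_ge0.
have {}MV : e x * mv_const n <=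
   16 * n%:R / s^-1 ^+ n * I + 16 * n%:R * 2 ^+ n *
    ((A0 + al ^+ 2 * (2 * m) ^+ n + a * (2 * m) ^+ n.+2) * s^-1 ^+ 2 +
     2 * (B0 + B1 * (2 * m) ^+ n + b * (2 * m) ^+ n.+1) * s^-1).
  apply: MV => //.
  - by rewrite !addr_ge0// mulr_ge0// sqr_ge0.
  - by rewrite !addr_ge0// mulr_ge0.
  - by move=> k z /Qnear[Dz _]; apply/pder_partial/dU/DU.
  - by move=> k z /Qnear[Dz _]; apply/pder_partial/dpU/DU.
  - by move=> z /Qnear[Dz _]; exact: ce.
  - by move=> k z /Qnear[Dz _]; exact/cpU/DU.
  - by move=> z /Qnear[Dz _]; exact: epos.
  - move=> z /Qnear[Dz ez]; apply: (le_trans (lap z Dz)); rewrite al2 -(addn2 n).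
    by apply: lerD; [apply: lerD|]; rewrite ?ler_wpM2l ?powle.
  - move=> z /Qnear[Dz ez] z0; apply: (le_trans (nrm z Dz z0)); rewrite -(addn1 n).
    by apply: lerD; [apply: lerD|]; rewrite ?ler_wpM2l ?powle.
  - by move=> z /Qnear[Dz _]; rewrite gD.
have est : m ^+ n <= K * ((A0 + al ^+ 2 * (2 * m) ^+ n + a * (2 * m) ^+ n.+2) * s^-1 ^+ 2 +
    (B0 + B1 * (2 * m) ^+ n + b * (2 * m) ^+ n.+1) * s^-1 + I / s^-1 ^+ n).
  rewrite mn -(ler_pM2r c0); apply: (le_trans MV).
  set A := A0 + _ + _; set B := B0 + _ + _.
  have A_ge0 : 0 <= A by rewrite !addr_ge0// mulr_ge0// sqr_ge0.
  have B_ge0 : 0 <= B by rewrite !addr_ge0// mulr_ge0.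
  have -> : K * (A * s^-1 ^+ 2 + B * s^-1 + I / s^-1 ^+ n) * mv_const n =
      16 * n%:R * 2 ^+ n * 2 * (A * s^-1 ^+ 2 + B * s^-1 + I / s^-1 ^+ n).
    by rewrite mulrAC KE.
  have -> : 16 * n%:R / s^-1 ^+ n * I = 16 * n%:R * (I / s^-1 ^+ n) by rewrite mulrAC mulrA.
  have : 0 <= I / s^-1 ^+ n by rewrite divr_ge0// exprn_ge0// ltW.
  have : 0 <= A * s^-1 ^+ 2 by rewrite mulr_ge0// sqr_ge0.
  move: (I / s^-1 ^+ n) (A * s^-1 ^+ 2) => P Q Q0 P0.
  have : n%:R * P <= n%:R * P * 2 ^+ n by rewrite ler_peMr// mulr_ge0.
  have : 0 <= n%:R * 2 ^+ n * Q by rewrite !mulr_ge0.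
  have : 0 <= n%:R * P by rewrite mulr_ge0.
  by lra.
have abs := heinz_absorb K0 a0 b0 al0 B10 m0 tau0 I0 Imu est.
apply: (heinz_conclude erefl n0 K0 Lam0 A00 B00 X0 I0 r0 tau0 _ l0 ltau _ abs).
  by rewrite /tau gerBl.
by rewrite mn.
Qed.
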